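(* Let $\rho^a,\rho^b\in\mathcal P(G)$. There exists $(\rho^*,v^*,m^* )$ such that $(\rho^*,v^* )$ is a minimizer of the problem $$\inf_{\rho,v}\int_0^1\frac12\langle v_t,v_t\rangle_{\theta(\rho_t)}\,dt\quad\text{subject to}\quad \dot\rho(t)+\mathrm{div}_G^\theta(\rho(t)v(t))+\mathrm{div}_G^\theta(\rho(t)\nabla_G\Sigma)\,\dot W^\delta(t)=0,\ \ \rho(0)=\rho^a,\ \rho(1)=\rho^b,$$ and $(\rho^*,m^* )$ is a minimizer of $\inf_{(\rho,m)\in C_F(\rho^a,\rho^b)}\mathcal A(\rho,m)$.
   Context: $G=(V,E)$ is a finite undirected connected graph without self loops or multiple edges, with nodes $1,\dots,N$ and all edge weights equal to $1$; $E$ is a symmetric set of ordered pairs and $N(i)$ is the set of neighbours of $i$. $\mathcal P(G)=\{\rho\in\mathbb R^N:\sum_j\rho_j=1,\ \rho_j\ge0\}$. $\theta_{ij}(\rho)=\frac{\rho_i+\rho_j}2$. $\mathcal S^{N\times N}$ is the set of real skew-symmetric $N\times N$ matrices; vector fields are elements of $\mathcal S^{N\times N}$ (only entries with $(i,j)\in E$ matter), with $\langle u,v\rangle_{\theta(\rho)}=\frac12\sum_{(i,j)\in E}u_{ij}v_{ij}\theta_{ij}(\rho)$. For $S\in\mathbb R^N$, $(\nabla_GS)_{ij}=S_i-S_j$; the divergence is $(\mathrm{div}_G^\theta(\rho v))_i=-\sum_{j\in N(i)}v_{ij}\theta_{ij}(\rho)$. $\Sigma=(\Sigma_i)\in\mathbb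 R^N$ is a given function on the nodes. $W$ is a standard one-dimensional Wiener process; $\delta=1/K$ with $K\in\mathbb N$, $t_k=k\delta$, and $W^\delta$ is the piecewise linear (Wong–Zakai) interpolation of $W$ at the points $t_k$, so $\dot W^\delta(t)=\frac{W(t_{k+1})-W(t_k)}{\delta}$ for $t\in[t_k,t_{k+1})$. Everything is understood pathwise, for a.e. fixed realization of $W$. In the first problem the competitors are $\rho\in H^1([0,1];\mathcal P(G))$ and measurable $v:[0,1]\to\mathcal S^{N\times N}$, the constraint holding for a.e. $t$. The feasible set $C_F(\rho^a,\rho^b)$ consists of the pairs $\rho\in H^1([0,1];\mathcal P(G))$, $m\in L^2([0,1];\mathcal S^{N\times N})$ with $\rho(0)=\rho^a$, $\rho(1)=\rho^b$ and, for all $i$ and a.e. $t$, $$\dot\rho_i(t)+\sum_{j\in N(i)}m_{ij}(t)+\sum_{j\in N(i)}(\Sigma_j-\Sigma_i)\theta_{ij}(\rho(t))\,\dot W^\delta(t)=0 .$$ The action is $\mathcal A(\rho,m)=\int_0^1\frac14\sum_{(i,j)\in E}L(\theta_{ij}(\rho),m_{ij})\,dt$, where $L(x,y)=y^2/x$ if $x>0$, $L(0,0)=0$, and $L(x,y)=\infty$ otherwise. *)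

(* Defs.v *)
From HB Require Import structures.
From mathcomp Require Export all_boot all_order all_algebra.
From mathcomp Require Export all_classical all_reals all_analysis.

Set Implicit Arguments.
Unset Strict Implicit.
Unset Printing Implicit Defensive.

Export Order.TTheory GRing.Theory Num.Theory.
Export numFieldNormedType.Exports.

#[export] Set Implicit Arguments.
#[export] Unset Strict Implicit.
#[export] Unset Printing Implicit Defensive.

Local Open Scope classical_set_scope.
Local Open Scope ring_scope.

(* The time set of a process is [0, +oo[: its values at negative times play no
   role. *)
Section wiener.
Context {d : measure_display} {T : measurableType d} {R : realType}.
Variable P : probability T R.

Definition increment (W : R -> {RV P >-> R}) (s t : R) : T -> R :=
  fun omega => W t omega - W s omega.

(* Taking some of the B k equal to the full set gives the product rule for
   every subfamily of increments. *)
Definition independent_increments (W : R -> {RV P >-> R}) : Prop :=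
  forall (n : nat) (t : nat -> R) (B : nat -> set R),
    0 <= t 0%N -> (forall k, (k < n)%N -> t k <= t k.+1) ->
    (forall k, measurable (B k)) ->
    P (\bigcap_(k in `I_n) (increment W (t k) (t k.+1) @^-1` B k)) =
    (\prod_(k < n) fine (P (increment W (t k) (t k.+1) @^-1` B k)))%:E.

(* normal_prob m s is parameterized by the standard deviation s. *)
Definition gaussian_increments (W : R -> {RV P >-> R}) : Prop :=
  forall (s t : R) (B : set R), 0 <= s -> s < t -> measurable B ->
    P (increment W s t @^-1` B) = normal_prob 0 (Num.sqrt (t - s)) B.

Definition standard_wiener (W : R -> {RV P >-> R}) : Prop :=
  [/\ {ae P, forall omega, W 0 omega = 0},
      independent_increments W,
      gaussian_increments W &
      {ae P, forall omega,
        {within (`[0, +oo[ : set R), continuous (fun t => W t omega)}}].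

End wiener.

(* Time derivative of the piecewise linear interpolation of the path w at the
   points k / K; for t >= 0, truncn (t * K) is the k such that t lies in
   [k / K, (k + 1) / K[. *)
Definition wong_zakai_deriv {R : realType} (K : nat) (w : R -> R) (t : R) : R :=
  let delta : R := K%:R^-1 in
  let k := Num.truncn (t * K%:R) in
  (w (k.+1%:R * delta) - w (k%:R * delta)) / delta.

Section graph.
Context {R : realType} {N : nat}.
Variable E : rel 'I_N.

Definition simple_connected_graph : Prop :=
  [/\ symmetric E, irreflexive E & forall i j, connect E i j].

Definition prob_simplex : set 'rV[R]_N :=
  [set rho | \sum_j rho 0 j = 1 /\ forall j, 0 <= rho 0 j].

Definition skew : set 'M[R]_N := [set u | u^T = - u].

Definition theta (rho : 'rV[R]_N) (i j : 'I_N) : R := (rho 0 i + rho 0 j) / 2.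

Definition inner_theta (rho : 'rV[R]_N) (u v : 'M[R]_N) : R :=
  2^-1 * \sum_i \sum_(j | E i j) u i j * v i j * theta rho i j.

Definition graph_grad (S : 'rV[R]_N) : 'M[R]_N :=
  \matrix_(i, j) (S 0 i - S 0 j).

(* graph_div rho v i is the i-th entry of div_G^theta (rho v). *)
Definition graph_div (rho : 'rV[R]_N) (v : 'M[R]_N) (i : 'I_N) : R :=
  - \sum_(j | E i j) v i j * theta rho i j.

End graph.

Section curves.
Context {R : realType}.
Local Notation mu := (@lebesgue_measure R).
Local Notation I01 := (`[0%R, 1%R]%classic : set R).

Definition L2_01 (f : R -> R) : Prop :=
  measurable_fun I01 f /\
  (\int[mu]_(t in I01) ((f t) ^+ 2)%:E < +oo)%E.

(* f is (the continuous representative of) an element of H^1([0,1]), with weak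
   derivative g: f is a primitive on [0,1] of the square integrable g. *)
Definition H1_deriv (f g : R -> R) : Prop :=
  L2_01 g /\
  forall t, 0 <= t <= 1 -> f t = f 0 + \int[mu]_(s in `[0, t]) g s.

Context {N : nat}.

(* rho belongs to H^1([0,1]; P(G)) with weak derivative drho. *)
Definition H1_simplex (rho drho : R -> 'rV[R]_N) : Prop :=
  (forall i, H1_deriv (fun t => rho t 0 i) (fun t => drho t 0 i)) /\
  (forall t, 0 <= t <= 1 -> prob_simplex (rho t)).

Definition measurable_field (v : R -> 'M[R]_N) : Prop :=
  (forall t, 0 <= t <= 1 -> skew (v t)) /\
  (forall i j, measurable_fun I01 (fun t => v t i j)).

Definition L2_field (m : R -> 'M[R]_N) : Prop :=
  (forall t, 0 <= t <= 1 -> skew (m t)) /\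
  (forall i j, L2_01 (fun t => m t i j)).

End curves.

Section problems.
Context {R : realType} {N : nat}.
Variables (E : rel 'I_N) (Sigma : 'rV[R]_N).
Local Notation mu := (@lebesgue_measure R).
Local Notation I01 := (`[0%R, 1%R]%classic : set R).
Local Notation curve := (R -> 'rV[R]_N).
Local Notation field := (R -> 'M[R]_N).

(* In both problems dW stands for the time derivative of the driving path. *)
Definition velocity_feasible (dW : R -> R) (rhoa rhob : 'rV[R]_N) :
    set (curve * field) :=
  [set p | [/\ measurable_field p.2, p.1 0 = rhoa, p.1 1 = rhob &
    exists drho : curve, H1_simplex p.1 drho /\
      {ae mu, forall t, 0 <= t <= 1 -> forall i,
        drho t 0 i + graph_div E (p.1 t) (p.2 t) i
          + graph_div E (p.1 t) (graph_grad Sigma) i * dW t = 0}]].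

Definition kinetic_energy (p : curve * field) : \bar R :=
  (\int[mu]_(t in I01)
     (2^-1 * inner_theta E (p.1 t) (p.2 t) (p.2 t))%:E)%E.

(* The set C_F(rhoa, rhob). *)
Definition flux_feasible (dW : R -> R) (rhoa rhob : 'rV[R]_N) :
    set (curve * field) :=
  [set p | [/\ L2_field p.2, p.1 0 = rhoa, p.1 1 = rhob &
    exists drho : curve, H1_simplex p.1 drho /\
      {ae mu, forall t, 0 <= t <= 1 -> forall i,
        drho t 0 i + \sum_(j | E i j) p.2 t i j
          + \sum_(j | E i j)
              (Sigma 0 j - Sigma 0 i) * theta (p.1 t) i j * dW t = 0}]].

Definition lagrangian (x y : R) : \bar R :=
  if 0 < x then (y ^+ 2 / x)%:E
  else if (x == 0) && (y == 0) then 0%E else +oo%E.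

Definition flux_action (p : curve * field) : \bar R :=
  (\int[mu]_(t in I01)
     ((4^-1)%:E *
      \sum_i \sum_(j | E i j) lagrangian (theta (p.1 t) i j) (p.2 t i j)))%E.

End problems.

Definition is_minimizer {R : realType} {X : Type} (C : set X) (J : X -> \bar R)
    (x : X) : Prop :=
  C x /\ forall y, C y -> (J x <= J y)%E.

(* Main.v *)
Require Import Defs.
From mathcomp Require Import measurable_realfun ring lra.

Local Open Scope classical_set_scope.
Local Open Scope ring_scope.

(** Once a realization of the Wiener process is fixed, the driving term dW is a
bounded step function of time ([wong_zakai_bounded]), and the statement becomes
the deterministic [pathwise_common_minimizer].

The flux problem is convex. The constraint is affine in the pair (rho, m), and
since L(x, y) is the supremum over a of 2 a y - a^2 x for x >= 0
([lagrangian_ge], [lagrangian_le]), the action is jointly convex and lower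
semicontinuous. The curve is recovered from its rate by
rho(t) = rho^a + int_0^t rho', so the unknown is a finite family of functions of
L2([0,1]): the entries of rho' and of m. A bound on the action bounds this
family in L2: theta <= 1 controls m by the action, and the continuity equation
then controls rho' ([action_coercive]).

Convexity makes the direct method work with strong convergence instead of weak
compactness ([L2_direct_method]). The sets of admissible families with action
at most inf + 1/(n+1) are nested and stable under midpoints; choosing in each
an element of almost minimal L2 norm, the parallelogram identity makes the
chosen sequence Cauchy ([nested_convex_selection]). The rate can be made
geometric, so the sequence converges almost everywhere and is dominated by an
integrable function ([riesz_fischer]). Dominated convergence carries the curves
and the constraint to the limit, and the Fatou lemma the action
([admissible_closed]).

The infimum is finite although rho^a and rho^b may lie on the boundary of the
simplex, where theta vanishes ([finite_action_competitor]). The competitor is a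
quadratic Bezier curve with the uniform distribution as middle control point,
run with a speed proportional to t (1 - t): then (rho')^2 = O(theta). A linear
choice of flow realizing rho', which exists because the graph is connected
([flow_exists]), keeps m^2 / theta bounded.

The two problems correspond through m = - theta v. Finite action forces m = 0
almost everywhere on {theta = 0}, so v = - m / theta (with value 0 where
theta = 0) is feasible with no more energy than m ([velocity_of_feasible]);
conversely a velocity of finite energy gives an L2 flux with no more action
([velocity_feasible_flux]). Hence one curve serves both problems. *)

(** * Almost minimal elements of nested convex sets *)

(** The infima of [N] over the sets [C n] increase to a finite limit, [sup D].
Points of [C n] with [N] close to this limit must be close to each other: their
midpoint stays in a set where [N] is almost at least [sup D], so the
parallelogram identity leaves almost nothing for [dist2]. The tolerances [e]
are free, so that a prescribed rate is obtained without extracting a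
subsequence. *)
Lemma nested_convex_selection (R : realType) (X : Type) (N : X -> R)
    (dist2 : X -> X -> R) (mid : X -> X -> X) (C : nat -> set X) (M : R)
    (e : nat -> R) :
  (forall n m, (n <= m)%N -> C m `<=` C n) ->
  (forall n x y, C n x -> C n y -> C n (mid x y)) ->
  (forall x y, C 0%N x -> C 0%N y ->
    dist2 x y + 4 * N (mid x y) = 2 * (N x + N y)) ->
  (forall x, C 0%N x -> 0 <= N x) ->
  (forall n, exists2 x, C n x & N x <= M) ->
  (forall k, 0 < e k) -> (forall k, e k.+1 <= e k) ->
  exists y : nat -> X, forall k, C k (y k) /\ dist2 (y k) (y k.+1) <= 8 * e k.
Proof.
move=> Cdecr Cmid para N0 NM e0 edecr.
pose D := [set r | exists n, forall x, C n x -> r <= N x].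
have supD : has_sup D.
  split; first by exists 0, 0%N.
  exists M => r [n rn]; have [x Cx Nx] := NM n.
  exact: le_trans (rn x Cx) Nx.
have pick k : exists z : X * nat, [/\ (k <= z.2)%N, C z.2 z.1,
    N z.1 <= sup D + e k & forall x, C z.2 x -> sup D - e k <= N x].
  (* [maxn k n]: far enough for the infimum, and not before index k. *)
  have [r [n rn] rD] := sup_adherent (e0 k) supD.
  have [x Cx Nx] : exists2 x, C (maxn k n) x & N x <= sup D + e k.
    apply: contrapT => /forall2NP H.
    have : D (sup D + e k).
      exists (maxn k n) => x Cx; have [//|/negP] := H x.
      by rewrite -ltNge => /ltW.
    move=> /(ub_le_sup supD.2); rewrite leNgt => /negP; apply.
    by rewrite ltrDl.
  exists (x, maxn k n); split => //=; first exact: leq_maxl.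
  move=> z Cz; apply: le_trans (ltW rD) _; apply: rn.
  exact: Cdecr (leq_maxr k n) _ Cz.
have [z zP] := choice pick.
exists (fun k => (z k).1) => k.
have [kz Cz Nz lez] := zP k; have [kz' Cz' Nz' lez'] := zP k.+1.
split; first exact: Cdecr kz _ Cz.
have C0 n x : C n x -> C 0%N x by exact: Cdecr.
have := para _ _ (C0 _ _ Cz) (C0 _ _ Cz').
suff : sup D - e k <= N (mid (z k).1 (z k.+1).1).
  by move: (edecr k) Nz Nz' => *; lra.
have [nm|nm] := leP (z k).2 (z k.+1).2.
  apply: lez; apply: Cmid => //; exact: Cdecr nm _ Cz'.
apply: le_trans (_ : sup D - e k.+1 <= _).
  by rewrite lerB.
apply: lez'; apply: Cmid => //; exact: Cdecr (ltW nm) _ Cz.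
Qed.

(** * Square integrable functions on the unit interval *)

Section L2.
Context {R : realType}.
Local Notation mu := (@lebesgue_measure R).
Local Notation I01 := (`[0%R, 1%R]%classic : set R).

Lemma I01E (t : R) : I01 t = (0 <= t <= 1) :> Prop.
Proof. by rewrite /= in_itv. Qed.

Lemma integrable_bounded01 (f : R -> R) (c : R) :
  measurable_fun I01 f -> (forall t, I01 t -> `|f t| <= c) ->
  mu.-integrable I01 (EFin \o f).
Proof.
move=> mf fc; apply: measurable_bounded_integrable => //.
  by rewrite /= lebesgue_measure_itv /= lte_fin ltr01 -EFinD ltry.
rewrite /bounded_near /=; near=> M.
by move=> t It; apply: le_trans (fc t It) _; near: M;
  apply: nbhs_pinfty_ge; rewrite num_real.
Unshelve. all: by end_near. Qed.

Lemma ae_imply (P Q : R -> Prop) : (forall t, P t -> Q t) ->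
  {ae mu, forall t, P t} -> {ae mu, forall t, Q t}.
Proof.
move=> PQ [N [mN N0 PN]]; exists N; split => // t nQ.
by apply: PN => Pt; exact/nQ/PQ.
Qed.

Lemma ae_imply2 (P Q S : R -> Prop) : (forall t, P t -> Q t -> S t) ->
  {ae mu, forall t, P t} -> {ae mu, forall t, Q t} -> {ae mu, forall t, S t}.
Proof.
move=> PQS aeP aeQ; apply: negligibleS (negligibleU aeP aeQ) => t nS.
by apply/not_andP => -[Pt Qt]; exact/nS/PQS.
Qed.

Lemma ae_forall_nat (P : nat -> R -> Prop) :
  (forall k, {ae mu, forall t, P k t}) -> {ae mu, forall t k, P k t}.
Proof.
move=> aeP; apply: negligibleS (negligible_bigcup aeP) => t /existsNP[k nP].
by exists k.
Qed.

Lemma measurable_sqr (D : set R) (f : R -> R) : measurable_fun D f ->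
  measurable_fun D (fun t => ((f t) ^+ 2)%:E).
Proof. by move=> mf; apply/measurable_EFinP; exact: measurable_funX. Qed.

Lemma integrable_lincomb (D : set R) (a b : R) (f g : R -> R) : measurable D ->
  mu.-integrable D (EFin \o f) -> mu.-integrable D (EFin \o g) ->
  mu.-integrable D (fun t => (a * f t + b * g t)%:E).
Proof.
move=> mD fi gi.
have iaf : mu.-integrable D (fun t => a%:E * (f t)%:E)%E by exact: integrableZl.
have ibg : mu.-integrable D (fun t => b%:E * (g t)%:E)%E by exact: integrableZl.
by apply: eq_integrable (integrableD _ iaf ibg).
Qed.

Lemma L2_sqr_integrable (f : R -> R) :
  L2_01 f -> mu.-integrable I01 (fun t => ((f t) ^+ 2)%:E).
Proof.
move=> [mf fi]; apply/integrableP; split.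
  by apply/measurable_EFinP; exact: measurable_funX.
under eq_integral do rewrite gee0_abs ?lee_fin ?sqr_ge0//.
exact: fi.
Qed.

Lemma L2_le (f : R -> R) (g : R -> \bar R) :
  measurable_fun I01 f -> (forall t, I01 t -> ((f t ^+ 2)%:E <= g t)%E) ->
  measurable_fun I01 g -> (\int[mu]_(t in I01) g t < +oo)%E -> L2_01 f.
Proof.
move=> mf fg mg gi; split => //; apply: le_lt_trans gi.
apply: ge0_le_integral => //.
- by move=> t _; rewrite lee_fin sqr_ge0.
- by apply/measurable_EFinP; exact: measurable_funX.
Qed.

Lemma L2_le_sqr_integrable (f : R -> R) (g : R -> R) :
  measurable_fun I01 f -> (forall t, I01 t -> f t ^+ 2 <= g t) ->
  mu.-integrable I01 (EFin \o g) -> L2_01 f.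
Proof.
move=> mf fg ig; apply: (L2_le (g := EFin \o g)) => //.
- by case/integrableP: ig.
- case/integrableP: ig => _; under eq_integral => t.
    rewrite inE => It; rewrite gee0_abs; last first.
      by rewrite lee_fin; apply: le_trans (fg t It); rewrite sqr_ge0.
    over.
  by [].
Qed.

Lemma L2_bounded (f : R -> R) (c : R) :
  measurable_fun I01 f -> (forall t, I01 t -> `|f t| <= c) -> L2_01 f.
Proof.
move=> mf fc; apply: (L2_le_sqr_integrable (g := fun=> c ^+ 2)) => //.
  move=> t It; rewrite -(real_normK (num_real (f t))) lerXn2r ?nnegrE//.
    exact: le_trans (fc t It).
  exact: fc.
by apply: (integrable_bounded01 (c := `|c ^+ 2|)).
Qed.

Lemma L2_integrable (f : R -> R) : L2_01 f -> mu.-integrable I01 (EFin \o f).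
Proof.
move=> f2; apply: (le_integrable _ _ _
    (integrableD _ (L2_sqr_integrable f2)
       (integrable_bounded01 (f := fun=> 1) (c := 1) _ _))) => //.
- by apply/measurable_EFinP; case: f2.
- move=> t _ /=; rewrite lee_fin [leRHS]ger0_norm ?addr_ge0 ?sqr_ge0//.
  have := sqr_ge0 (`|f t| - 1); rewrite -[f t ^+ 2]real_normK ?num_real//.
  by have := normr_ge0 (f t); move: `|_| => x x0 H; nra.
- by move=> t _ /=; rewrite normr1.
Qed.

Lemma L2_lincomb (a b : R) (f g : R -> R) :
  L2_01 f -> L2_01 g -> L2_01 (fun t => a * f t + b * g t).
Proof.
move=> f2 g2; have [mf _] := f2; have [mg _] := g2.
apply: (L2_le_sqr_integrable
  (g := fun t => (2 * a ^+ 2) * f t ^+ 2 + (2 * b ^+ 2) * g t ^+ 2)).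
- by apply: measurable_funD; apply: measurable_funM.
- move=> t _; have := sqr_ge0 (a * f t - b * g t); nra.
- by apply: integrable_lincomb => //; exact: L2_sqr_integrable.
Qed.

Lemma L2_sub (f g : R -> R) : L2_01 f -> L2_01 g -> L2_01 (fun t => f t - g t).
Proof.
move=> f2 g2; have := L2_lincomb 1 (-1) f2 g2.
by congr L2_01; apply/funext => t; rewrite mul1r mulN1r.
Qed.

Lemma L2_mid (f g : R -> R) :
  L2_01 f -> L2_01 g -> L2_01 (fun t => (f t + g t) / 2).
Proof.
move=> f2 g2; have := L2_lincomb 2^-1 2^-1 f2 g2.
by congr L2_01; apply/funext => t; rewrite -mulrDr mulrC.
Qed.

Definition sqnorm (f : R -> R) : R := \int[mu]_(t in I01) (f t) ^+ 2.

Lemma sqnorm_ge0 f : 0 <= sqnorm f.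
Proof. by apply: Rintegral_ge0 => t _; rewrite sqr_ge0. Qed.

Lemma sqnormE f : L2_01 f ->
  (sqnorm f)%:E = (\int[mu]_(t in I01) ((f t) ^+ 2)%:E)%E.
Proof.
move=> f2; rewrite /sqnorm /Rintegral fineK//.
exact: integrable_fin_num (L2_sqr_integrable f2).
Qed.

Lemma parallelogram (f g : R -> R) : L2_01 f -> L2_01 g ->
  sqnorm (fun t => f t - g t) + 4 * sqnorm (fun t => (f t + g t) / 2) =
  2 * (sqnorm f + sqnorm g).
Proof.
move=> f2 g2; rewrite /sqnorm.
have i1 := L2_sqr_integrable (L2_sub f2 g2).
have i2 := L2_sqr_integrable (L2_mid f2 g2).
have i3 := L2_sqr_integrable f2.
have i4 := L2_sqr_integrable g2.
rewrite -RintegralD//.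
rewrite -RintegralZl// -RintegralZl//; last first.
  exact: (integrableD _ i3 i4).
rewrite -RintegralD//; last first.
  exact: (integrableZl _ 4 i2).
by apply: eq_Rintegral => t _; field.
Qed.

(** The form in which the Fatou lemma is used: an almost everywhere lower
bound by a lower limit, and integrals bounded up to a vanishing error. *)
Lemma fatou_le (F : nat -> R -> \bar R) (f : R -> \bar R) (D : set R)
    (c : R) (e : nat -> R) : measurable D ->
  (forall k, measurable_fun D (F k)) -> (forall k t, D t -> 0 <= F k t)%E ->
  measurable_fun D f -> (forall t, D t -> 0 <= f t)%E ->
  {ae mu, forall t, D t -> (f t <= limn_einf (F ^~ t))%E} ->
  (forall k, \int[mu]_(t in D) F k t <= (c + e k)%:E)%E ->
  e @ \oo --> 0 ->
  (\int[mu]_(t in D) f t <= c%:E)%E.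
Proof.
move=> mD mF F0 mf f0 fF Fc e0.
have L0 t : D t -> (0 <= limn_einf (F ^~ t))%E.
  move=> Dt; rewrite limn_einf_lim; apply: lime_ge.
    exact: is_cvg_einfs.
  apply: nearW => n; apply: le_ereal_inf_tmp => _ [k /= _ <-].
  exact: F0.
apply: (le_trans (y := \int[mu]_(t in D) limn_einf (F ^~ t)))%E.
  apply: ae_ge0_le_integral => //.
  apply: measurableT_comp => //; apply: measurable_fun_limn_esup => k.
  exact: measurableT_comp _ (mF k).
apply: le_trans (fatou mu mD mF F0) _.
have ce : (fun k => (c + e k)%:E) @ \oo --> c%:E.
  apply: cvg_EFin; first exact: nearW.
  by rewrite -[c in _ --> c]addr0; apply: cvgD => //; exact: cvg_cst.
have [<- _] := cvg_limn_einf_sup ce.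
rewrite !limn_einf_lim; apply: lee_lim; try exact: is_cvg_einfs.
apply: nearW => n; apply: le_ereal_inf_tmp => _ [k /= nk <-].
apply: le_trans (Fc k); apply: ereal_inf_lbound; by exists k.
Qed.

Lemma integral_mid_le (F G : R -> \bar R) (c : \bar R) :
  measurable_fun I01 F -> (forall t, I01 t -> 0 <= F t)%E ->
  measurable_fun I01 G -> (forall t, I01 t -> 0 <= G t)%E ->
  (\int[mu]_(t in I01) F t <= c)%E -> (\int[mu]_(t in I01) G t <= c)%E ->
  (\int[mu]_(t in I01) (2^-1%:E * F t + 2^-1%:E * G t) <= c)%E.
Proof.
move=> mF F0 mG G0 Fc Gc.
have half0 : (0 <= 2^-1%:E :> \bar R)%E by rewrite lee_fin.
rewrite ge0_integralD//; last 4 first.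
- by move=> t It; apply: mule_ge0 => //; exact: F0.
- by apply: emeasurable_funM => //.
- by move=> t It; apply: mule_ge0 => //; exact: G0.
- by apply: emeasurable_funM => //.
rewrite !ge0_integralZl//.
apply: (@le_trans _ _ (2^-1%:E * c + 2^-1%:E * c)%E).
  by apply: leeD; apply: lee_wpmul2l.
have c0 : (0 <= c)%E by apply: le_trans Fc; exact: integral_ge0.
rewrite -ge0_muleDl// -EFinD (_ : 2^-1 + 2^-1 = 1); last by field.
by rewrite mul1e.
Qed.

End L2.

(** * Strong compactness along a fast Cauchy sequence *)

Section riesz_fischer.
Context {R : realType}.
Local Notation mu := (@lebesgue_measure R).
Local Notation I01 := (`[0%R, 1%R]%classic : set R).

(** From 2 |x| <= r x^2 + 1/r. The free weight [r] replaces Hoelder: for a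
squared norm of order 4^-k, the choice r = 2^k bounds the L1 norm by a multiple
of 2^-k, which is summable. *)
Lemma L1_le_sqnorm (f : R -> R) (r : R) : L2_01 f -> 0 < r ->
  \int[mu]_(t in I01) `|f t| <= r * sqnorm f + r^-1.
Proof.
move=> f2 r0.
have i1 : mu.-integrable I01 (fun t => (r * f t ^+ 2 + r^-1 * 1)%:E).
  apply: (integrable_lincomb r r^-1 _ (L2_sqr_integrable f2)) => //.
  by apply: (integrable_bounded01 (c := 1)) => // t _; rewrite normr1.
have -> : r * sqnorm f + r^-1 = \int[mu]_(t in I01) (r * f t ^+ 2 + r^-1 * 1).
  have i2 := L2_sqr_integrable f2.
  rewrite RintegralD//; [|exact: (integrableZl _ r i2)|]; last first.
    apply: (integrable_bounded01 (c := `|r^-1|)) => // t _.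
    by rewrite mulr1.
  rewrite RintegralZl// Rintegral_cst//= lebesgue_measure_itv/= lte_fin ltr01.
  by rewrite -EFinD subr0/= !mulr1.
apply: le_Rintegral => //.
  exact: integrable_norm (L2_integrable f2).
move=> t _ /=; have := sqr_ge0 (r * `|f t| - 1).
rewrite -[f t ^+ 2]real_normK ?num_real// mulr1.
have r1 : r * r^-1 = 1 by rewrite divff// gt_eqF.
have ri : 0 < r^-1 by rewrite invr_gt0.
have := normr_ge0 (f t); move: `|f t| => x x0 H.
have -> : r * x ^+ 2 + r^-1 = r^-1 * ((r * x) ^+ 2 + 1).
  rewrite mulrDr mulr1 exprMn [r ^+ 2]expr2 -!mulrA [r^-1 * _]mulrA.
  by rewrite mulVf ?mul1r// gt_eqF.
have -> : x = r^-1 * (r * x) by rewrite mulrA mulVf ?mul1r// gt_eqF.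
rewrite ler_pM2l// mulrA divff ?mul1r ?gt_eqF//.
have : 0 <= r * x by rewrite mulr_ge0// ltW.
by nra.
Qed.

(** The increments are summable in L1, hence their pointwise sum [S] is
integrable and finite almost everywhere. Where [S] is finite the sequences
converge, bounded by their first term plus [S]. The limit is in L2 by Fatou.
The set where [S] is finite is the same for all coordinates, and the limit is
set to 0 off it: this gives the alternative valid at every time. *)
Lemma riesz_fischer (A : finType) (f : nat -> A -> R -> R) (C M : R) :
  0 <= C ->
  (forall k a, L2_01 (f k a)) ->
  (forall k a, sqnorm (fun t => f k.+1 a t - f k a t) <= C / (4 ^+ k)) ->
  (forall k a, sqnorm (f k a) <= M) ->
  exists (h : A -> R -> R) (G : R -> R),
    [/\ forall a, L2_01 (h a), mu.-integrable I01 (EFin \o G),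
      forall t, I01 t -> (forall a, f k a t @[k --> \oo] --> h a t) \/
                         (forall a, h a t = 0),
      {ae mu, forall t, I01 t -> forall a, f k a t @[k --> \oo] --> h a t} &
      {ae mu, forall t, I01 t -> forall a k, `|f k a t| <= G t}].
Proof.
move=> C0 f2 fC fM.
have mf k a : measurable_fun I01 (f k a) by case: (f2 k a).
pose d k a t := f k.+1 a t - f k a t.
have d2 k a : L2_01 (d k a) by exact: L2_sub.
have md k a : measurable_fun I01 (d k a) by case: (d2 k a).
pose g k t : R := \sum_a `|d k a t|.
have g0 k t : 0 <= g k t by exact: sumr_ge0.
pose u k t : \bar R := (g k t)%:E.
have u0 k t : (0 <= u k t)%E by rewrite lee_fin.
have mu_ k : measurable_fun I01 (u k).
  apply/measurable_EFinP; apply: measurable_sum => a.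
  exact: measurableT_comp.
pose S t : \bar R := (\sum_(0 <= k <oo) u k t)%E.
have S0 t : (0 <= S t)%E by exact: nneseries_ge0.
have mS : measurable_fun I01 S.
  exact: ge0_emeasurable_sum.
have iu k : (\int[mu]_(t in I01) u k t <=
    (2 * ((C + 1) *+ #|A|) / (2 ^ k.+1)%:R)%:E)%E.
  under eq_integral do rewrite /u /g -sumEFin.
  rewrite ge0_integral_sum//; last first.
    move=> a; apply/measurable_EFinP.
    exact: measurableT_comp _ (md k a).
  have -> : 2 * ((C + 1) *+ #|A|) / (2 ^ k.+1)%:R =
      \sum_(a : A) (C + 1) / 2 ^+ k :> R.
    rewrite sumr_const natrX exprS -[in RHS]mulr_natr -[in LHS]mulr_natr.
    by field; rewrite expf_neq0.
  rewrite -sumEFin; apply: lee_sum => a _.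
  have int_d := integrable_norm (L2_integrable (d2 k a)).
  rewrite -(fineK (integrable_fin_num _ int_d))// lee_fin.
  have := L1_le_sqnorm (d2 k a) (_ : 0 < 2 ^+ k).
  rewrite exprn_gt0// => /(_ isT) /le_trans; apply.
  have k0 : (0 : R) < 2 ^+ k by rewrite exprn_gt0.
  apply: (le_trans (y := 2 ^+ k * (C / 4 ^+ k) + (2 ^+ k)^-1)).
    by rewrite lerD2r ler_pM2l//; exact: fC.
  rewrite (_ : 4 = 2 * 2 :> R) ?exprMn; last by ring.
  rewrite le_eqVlt; apply/orP; left; apply/eqP; field.
  by rewrite gt_eqF.
have iS : mu.-integrable I01 S.
  apply/integrableP; split=> //.
  under eq_integral do rewrite gee0_abs//.
  rewrite integral_nneseries//.
  apply: le_lt_trans (_ : (2 * ((C + 1) *+ #|A|))%:E < +oo)%E; last exact: ltry.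
  apply: le_trans (epsilon_trick0 xpredT _); last first.
    by rewrite mulr_ge0// mulrn_wge0// addr_ge0.
  apply: lee_nneseries => [k _ _|k _]; last exact: iu.
  by apply: integral_ge0 => t _.
have partial n t : ((\sum_(0 <= k < n) g k t)%:E <= S t)%E.
  rewrite -sumEFin; apply: (nneseries_lim_ge (u_ := u ^~ t)) => k _ _.
  exact: u0.
have telesc n a t : \sum_(0 <= k < n) d k a t = f n a t - f 0%N a t.
  by rewrite /d (telescope_sumr (fun k => f k a t)).
(* Absolute convergence of the telescoping series of increments. *)
have cvgf a t : (S t < +oo)%E -> cvgn (f ^~ a ^~ t).
  move=> St.
  have : cvgn [normed series (fun k => d k a t)].
    apply: nondecreasing_is_cvgn.
      by apply: nondecreasing_series => *; rewrite /= normr_ge0.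
    exists (fine (S t)) => _ [n _ <-]; rewrite -lee_fin fineK ?ge0_fin_numE//.
    apply: le_trans (partial n t); rewrite lee_fin /series/=.
    apply: ler_sum => k _; rewrite /g (bigD1 a)//= lerDl.
    exact: sumr_ge0.
  move=> /normed_cvg cs.
  have -> : f ^~ a ^~ t = (fun n => series (fun k => d k a t) n + f 0%N a t).
    by apply/funext => n; rewrite /series/= telesc subrK.
  by apply: is_cvgD => //; exact: is_cvg_cst.
have fS n a t : (S t < +oo)%E -> `|f n a t| <= `|f 0%N a t| + fine (S t).
  move=> St; rewrite -[f n a t](subrK (f 0%N a t)) addrC.
  apply: le_trans (ler_normD _ _) _; rewrite lerD2l -telesc.
  rewrite -lee_fin fineK ?ge0_fin_numE//.
  apply: le_trans (partial n t); rewrite lee_fin.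
  apply: le_trans (ler_norm_sum _ _ _) _.
  apply: ler_sum => k _; rewrite /g (bigD1 a)//= lerDl.
  exact: sumr_ge0.
pose h a t : R := if (S t < +oo)%E then limn (f ^~ a ^~ t) else 0.
pose fh k a t : R := if (S t < +oo)%E then f k a t else 0.
have fhh a t : fh ^~ a ^~ t @ \oo --> h a t.
  rewrite /fh /h; case: ifPn => St; last exact: cvg_cst.
  exact: cvgf.
have mSoo : measurable_fun I01 (fun t => (S t < +oo)%E).
  apply: (measurable_fun_bool true) => //.
  rewrite (_ : _ @^-1` _ = [set t | (S t < +oo)%E])//.
  exact: emeasurable_fun_infty_o.
have mfh k a : measurable_fun I01 (fh k a).
  apply: measurable_fun_if => //.
  apply: measurable_funS (mf k a) => //; exact: subIsetl.
have mh a : measurable_fun I01 (h a).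
  by apply: (measurable_fun_cvg (fun k => mfh k a)) => t _; exact: fhh.
have aeS : {ae mu, forall t, I01 t -> (S t < +oo)%E}.
  apply: ae_imply (integrable_ae _ iS) => // t + It => /(_ It).
  by rewrite ge0_fin_numE.
exists h, (fun t => \sum_a `|f 0%N a t| + fine (S t)); split.
- move=> a; split => //.
  apply: le_lt_trans (_ : M%:E < +oo)%E; last exact: ltry.
  apply: (fatou_le (F := fun k t => ((fh k a t) ^+ 2)%:E) (e := fun=> 0)) => //.
  + by move=> k; exact: measurable_sqr (mfh k a).
  + by move=> k t _; rewrite lee_fin sqr_ge0.
  + exact: measurable_sqr (mh a).
  + by move=> t _; rewrite lee_fin sqr_ge0.
  + apply: aeW => t _.
    have : (fun k => ((fh k a t) ^+ 2)%:E) @ \oo --> ((h a t) ^+ 2)%:E.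
      apply: cvg_EFin; first exact: nearW.
      by apply: (@cvgM _ _ _ _ (fh ^~ a ^~ t) (fh ^~ a ^~ t)).
    by move=> /cvg_limn_einf_sup[-> _].
  + move=> k; rewrite addr0; apply: le_trans (_ : (sqnorm (f k a))%:E <= _)%E.
      rewrite sqnormE//; apply: ge0_le_integral => //.
      * by move=> t _; rewrite lee_fin sqr_ge0.
      * exact: (measurable_sqr (mfh k a)).
      * exact: (measurable_sqr (mf k a)).
      * move=> t _; rewrite lee_fin /fh; case: ifPn => // _.
        by rewrite expr0n/= sqr_ge0.
    by rewrite lee_fin.
  + exact: cvg_cst.
- have i0 : mu.-integrable I01 (fun t => (\sum_a `|f 0%N a t|)%:E).
    rewrite (_ : (fun t => _) = (fun t => \sum_a (`|f 0%N a t|)%:E)%E); last first.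
      by apply/funext => t; rewrite sumEFin.
    apply: integrable_sum => // a _.
    exact: integrable_norm (L2_integrable (f2 0%N a)).
  have iS' : mu.-integrable I01 (fun t => (fine (S t))%:E).
    apply: le_integrable iS => //.
      by apply/measurable_EFinP; exact: measurableT_comp _ mS.
    move=> t _; rewrite gee0_abs ?lee_fin ?fine_ge0// gee0_abs//.
    by case: (S t) (S0 t) => //= *; rewrite ?leey.
  have := integrable_lincomb 1 1 _ i0 iS'; rewrite (_ : (fun t => _) =
    (fun t => (\sum_a `|f 0%N a t| + fine (S t))%:E)); first exact.
  by apply/funext => t; rewrite !mul1r.
- move=> t It; have [St|St] := boolP (S t < +oo)%E; [left|right] => a.
    by rewrite /h St; exact: cvgf.
  by rewrite /h (negbTE St).
- apply: ae_imply aeS => t St It a; rewrite /h St//.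
  exact/cvgf/St.
- apply: ae_imply aeS => t St It a k.
  apply: le_trans (fS k a t (St It)) _; rewrite lerD2r (bigD1 a)//= lerDl.
  exact: sumr_ge0.
Qed.

End riesz_fischer.

(** * The direct method in a product of L2 spaces *)

Section direct_method.
Context {R : realType} {A : finType}.
Local Notation mu := (@lebesgue_measure R).
Local Notation I01 := (`[0%R, 1%R]%classic : set R).

Definition midfam (f g : A -> R -> R) : A -> R -> R :=
  fun a t => (f a t + g a t) / 2.

(** The alternative at every time [t] is what lets constraints that are imposed
at every time, such as skew symmetry, pass to the limit: they are stable under
limits and satisfied by 0. *)
Definition dominated_limit (f : nat -> A -> R -> R) (h : A -> R -> R) : Prop :=
  exists G : R -> R,
    [/\ mu.-integrable I01 (EFin \o G),
      forall t, I01 t -> (forall a, f k a t @[k --> \oo] --> h a t) \/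
                         (forall a, h a t = 0),
      {ae mu, forall t, I01 t -> forall a, f k a t @[k --> \oo] --> h a t} &
      {ae mu, forall t, I01 t -> forall a k, `|f k a t| <= G t}].

(** Existence of a minimizer without weak compactness: midpoint convexity
upgrades a suitable minimizing sequence to a strongly convergent one. *)
Theorem L2_direct_method (X : set (A -> R -> R)) (J : (A -> R -> R) -> \bar R) :
  (forall f, X f -> forall a, L2_01 (f a)) ->
  (forall f, X f -> 0 <= J f)%E ->
  (forall f g c, X f -> X g -> (J f <= c)%E -> (J g <= c)%E ->
    X (midfam f g) /\ (J (midfam f g) <= c)%E) ->
  (forall c : R, exists M : R, forall f, X f -> (J f <= c%:E)%E ->
    forall a, sqnorm (f a) <= M) ->
  (forall f h (c : R), (forall k, X (f k)) ->
    (forall k, J (f k) <= (c + k.+1%:R^-1)%:E)%E ->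
    (forall a, L2_01 (h a)) -> dominated_limit f h ->
    X h /\ (J h <= c%:E)%E) ->
  (exists2 f, X f & (J f < +oo)%E) ->
  exists2 f, X f & forall g, X g -> (J f <= J g)%E.
Proof.
move=> XL2 J0 Jmid coer clos [f0 Xf0 Jf0].
pose m := ereal_inf (J @` X).
have m_lb g : X g -> (m <= J g)%E by move=> Xg; apply: ereal_inf_lbound; exists g.
have m0 : (0 <= m)%E by apply: le_ereal_inf_tmp => _ [g Xg <-]; exact: J0.
have mfin : m \is a fin_num.
  by rewrite ge0_fin_numE//; exact: le_lt_trans (m_lb _ Xf0) Jf0.
pose c := fine m.
have mE : m = c%:E by rewrite fineK.
pose C (n : nat) := [set f | X f /\ (J f <= (c + n.+1%:R^-1)%:E)%E].
have [M MP] := coer (c + 1).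
pose N (f : A -> R -> R) := \sum_a sqnorm (f a).
pose D f g := N (fun a t => g a t - f a t).
have C0 f : C 0%N f -> X f /\ (J f <= (c + 1)%:E)%E.
  by move=> [Xf]; rewrite invr1.
have [y yP] : exists y : nat -> A -> R -> R,
    forall k, C k (y k) /\ D (y k) (y k.+1) <= 8 * (4 ^- k).
  apply: (@nested_convex_selection _ _ N D midfam C (\sum_(a : A) M)
    (fun k => 4 ^- k)).
  - move=> n k nk f [Xf Jf]; split=> //; apply: le_trans Jf _.
    by rewrite lee_fin lerD2l lef_pV2 ?posrE ?ltr0n// ler_nat ltnS.
  - by move=> n f g [Xf Jf] [Xg Jg]; exact: Jmid.
  - move=> f g /C0[Xf _] /C0[Xg _]; rewrite /D /N -big_split/= !mulr_sumr.
    rewrite -big_split/=; apply: eq_bigr => a _.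
    rewrite [sqnorm (f a) + _]addrC -(parallelogram (XL2 _ Xg a) (XL2 _ Xf a)).
    congr (_ + 4 * sqnorm _).
    by apply/funext => t; rewrite /midfam addrC.
  - by move=> f _; apply: sumr_ge0 => a _; exact: sqnorm_ge0.
  - move=> n.
    have n0 : 0 < n.+1%:R^-1 :> R by rewrite invr_gt0 ltr0n.
    have [_ [f Xf <-] Jf] := lb_ereal_inf_adherent n0 mfin.
    have Jfn : (J f <= (c + n.+1%:R^-1)%:E)%E.
      by rewrite EFinD -mE; exact: ltW.
    exists f; first by split.
    apply: ler_sum => a _; apply: MP => //; apply: le_trans Jfn _.
    by rewrite lee_fin lerD2l invf_le1 ?ltr0n// ler1n.
  - by move=> k; rewrite invr_gt0 exprn_gt0.
  - move=> k; rewrite lef_pV2 ?posrE ?exprn_gt0// exprS.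
    by rewrite ler_peMl ?exprn_ge0// ler1n.
have Xy k : X (y k) by case: (yP k) => -[].
have Jy k : (J (y k) <= (c + k.+1%:R^-1)%:E)%E by case: (yP k) => -[].
have [h [G [hL2 iG dich aeh aeG]]] : exists (h : A -> R -> R) (G : R -> R),
    [/\ forall a, L2_01 (h a), mu.-integrable I01 (EFin \o G),
      forall t, I01 t -> (forall a, y k a t @[k --> \oo] --> h a t) \/
                         (forall a, h a t = 0),
      {ae mu, forall t, I01 t -> forall a, y k a t @[k --> \oo] --> h a t} &
      {ae mu, forall t, I01 t -> forall a k, `|y k a t| <= G t}].
  apply: (@riesz_fischer _ _ y 8 M) => //.
  - by move=> k a; exact: XL2.
  - move=> k a; case: (yP k) => _; apply: le_trans.
    rewrite /D /N (bigD1 a)//= lerDl; apply: sumr_ge0 => b _.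
    exact: sqnorm_ge0.
  - move=> k a; apply: MP => //; apply: le_trans (Jy k) _.
    by rewrite lee_fin lerD2l invf_le1 ?ltr0n// ler1n.
have [Xh Jh] : X h /\ (J h <= c%:E)%E.
  by apply: (clos y) => //; exists G.
by exists h => // g Xg; apply: le_trans Jh _; rewrite -mE; exact: m_lb.
Qed.

End direct_method.

(** * Lower limits and the Lagrangian *)

Section liminf.
Context {R : realType}.
Implicit Types u v : (\bar R)^nat.

Lemma le_limn_einf u v : (forall n, u n <= v n)%E ->
  (limn_einf u <= limn_einf v)%E.
Proof.
move=> uv; rewrite !limn_einf_lim; apply: lee_lim; try exact: is_cvg_einfs.
apply: nearW => n; apply: le_ereal_inf_tmp => _ [k /= nk <-].
by apply: le_trans (uv k); apply: ereal_inf_lbound; exists k.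
Qed.

Lemma limn_einf_ge0 u : (forall n, 0 <= u n)%E -> (0 <= limn_einf u)%E.
Proof.
move=> u0; rewrite limn_einf_lim; apply: lime_ge; first exact: is_cvg_einfs.
by apply: nearW => n; apply: le_ereal_inf_tmp => _ [k /= _ <-].
Qed.

(** Lower limits are only superadditive, which is the direction needed to sum
the lower semicontinuity of the terms of the action. *)
Lemma limn_einfD_le u v : (forall n, 0 <= u n)%E -> (forall n, 0 <= v n)%E ->
  (limn_einf u + limn_einf v <= limn_einf (fun n => u n + v n))%E.
Proof.
move=> u0 v0.
have := limn_einf_ge0 u0; have := limn_einf_ge0 v0.
rewrite !limn_einf_lim => v0' u0'.
rewrite -limeD; [|exact: is_cvg_einfs|exact: is_cvg_einfs|exact: ge0_adde_def].
apply: lee_lim; [|exact: is_cvg_einfs|].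
  apply: is_cvgeD; [exact: ge0_adde_def|exact: is_cvg_einfs|].
  exact: is_cvg_einfs.
apply: nearW => n; apply: le_ereal_inf_tmp => _ [k /= nk <-].
by apply: leeD; apply: ereal_inf_lbound; exists k.
Qed.

Lemma limn_einf_sum_le (I : Type) (s : seq I) (P : pred I)
    (u : I -> (\bar R)^nat) : (forall i n, 0 <= u i n)%E ->
  (\sum_(i <- s | P i) limn_einf (u i) <=
   limn_einf (fun n => \sum_(i <- s | P i) u i n))%E.
Proof.
move=> u0; elim: s => [|i s IH].
  by rewrite big_nil; apply: limn_einf_ge0 => n; rewrite big_nil.
rewrite big_cons (_ : (fun n => _) = (fun n => if P i then
    u i n + \sum_(j <- s | P j) u j n else \sum_(j <- s | P j) u j n)%E);
  last by apply/funext => n; rewrite big_cons.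
case: ifP => // _.
apply: le_trans (leeD2l _ IH) _; apply: limn_einfD_le => // n.
exact: sume_ge0.
Qed.

Lemma limn_einf_Zl (c : R) u : 0 <= c -> (forall n, 0 <= u n)%E ->
  (c%:E * limn_einf u <= limn_einf (fun n => c%:E * u n))%E.
Proof.
move=> c0 u0; rewrite !limn_einf_lim.
rewrite -limeMl//; last exact: is_cvg_einfs.
apply: lee_lim; [|exact: is_cvg_einfs|].
  by apply: is_cvgeZl => //; exact: is_cvg_einfs.
apply: nearW => n; apply: le_ereal_inf_tmp => _ [k /= nk <-].
by apply: lee_wpmul2l => //; apply: ereal_inf_lbound; exists k.
Qed.

Lemma cvg_sumr (I : Type) (s : seq I) (P : pred I) (u : I -> nat -> R)
    (l : I -> R) : (forall i, P i -> u i k @[k --> \oo] --> l i) ->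
  \sum_(i <- s | P i) u i k @[k --> \oo] --> \sum_(i <- s | P i) l i.
Proof.
move=> ul; elim: s => [|i s IH].
  by rewrite big_nil; under eq_fun do rewrite big_nil; exact: cvg_cst.
rewrite big_cons (_ : (fun k => _) = (fun k => if P i then
    u i k + \sum_(j <- s | P j) u j k else \sum_(j <- s | P j) u j k));
  last by apply/funext => k; rewrite big_cons.
by case: ifP => // /ul ui; exact: cvgD.
Qed.

End liminf.

Section lagrangian.
Context {R : realType}.
Implicit Types (x y a c : R) (z : \bar R).

(** Together with [lagrangian_le], this expresses the Lagrangian for x >= 0 as
the supremum over [a] of functions that are linear in (x, y). Convexity and
lower semicontinuity follow with no case analysis on x = 0. *)
Lemma lagrangian_ge x y a : 0 <= x ->
  ((2 * a * y - a ^+ 2 * x)%:E <= lagrangian x y)%E.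
Proof.
rewrite /lagrangian le_eqVlt => /predU1P[<-|x0].
  rewrite ltxx eqxx/=; case: eqP => [->|_]; last exact: leey.
  by rewrite !mulr0 subr0.
rewrite x0 lee_fin ler_pdivlMr//.
have := sqr_ge0 (y - a * x); nra.
Qed.

Lemma lagrangian_ge0 x y : 0 <= x -> (0 <= lagrangian x y)%E.
Proof.
by move=> /lagrangian_ge-/(_ y 0); rewrite mulr0 mul0r expr0n/= mul0r subr0.
Qed.

(** The supremum is attained at a = y / x when x > 0; when x = 0 and y <> 0 the
linear functions are unbounded. *)
Lemma lagrangian_le x y z : 0 <= x ->
  (forall a, ((2 * a * y - a ^+ 2 * x)%:E <= z)%E) -> (lagrangian x y <= z)%E.
Proof.
rewrite /lagrangian le_eqVlt => /predU1P[<-|x0] H.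
  rewrite ltxx eqxx/=; case: eqP => [_|/eqP y0].
    by have := H 0; rewrite mulr0 mul0r expr0n/= mul0r subr0.
  case: z H => [r|//|] H.
    have := H ((r + 1) / (2 * y)); rewrite mulr0 subr0 lee_fin.
    have -> : 2 * ((r + 1) / (2 * y)) * y = r + 1 by field.
    by rewrite leNgt ltrDl ltr01.
  by have := H 0.
have := H (y / x); rewrite x0; congr (_ <= _)%E; congr EFin; field.
by rewrite gt_eqF.
Qed.

Lemma lagrangian_mid x1 y1 x2 y2 : 0 <= x1 -> 0 <= x2 ->
  (lagrangian ((x1 + x2) / 2) ((y1 + y2) / 2) <=
   2^-1%:E * lagrangian x1 y1 + 2^-1%:E * lagrangian x2 y2)%E.
Proof.
move=> x10 x20; apply: lagrangian_le => [|a]; first by rewrite divr_ge0 ?addr_ge0.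
have L1 := lagrangian_ge y1 a x10; have L2 := lagrangian_ge y2 a x20.
rewrite (_ : 2 * a * _ - _ = 2^-1 * (2 * a * y1 - a ^+ 2 * x1) +
  2^-1 * (2 * a * y2 - a ^+ 2 * x2)); last by field.
by rewrite EFinD !EFinM; apply: leeD; apply: lee_wpmul2l.
Qed.

(** A supremum of continuous functions is lower semicontinuous. *)
Lemma lagrangian_lsc (x y : nat -> R) x0 y0 : (forall k, 0 <= x k) ->
  x @ \oo --> x0 -> y @ \oo --> y0 ->
  (lagrangian x0 y0 <= limn_einf (fun k => lagrangian (x k) (y k)))%E.
Proof.
move=> xk0 xx yy; apply: lagrangian_le => [|a].
  by rewrite -(cvg_lim _ xx)//; apply: limr_ge; [exact/cvgP/xx|exact: nearW].
have : (fun k => (2 * a * y k - a ^+ 2 * x k)%:E) @ \oo -->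
    (2 * a * y0 - a ^+ 2 * x0)%:E.
  apply: cvg_EFin; first exact: nearW.
  by apply: cvgB; (apply: cvgM; [exact: cvg_cst|]).
move=> /cvg_limn_einf_sup[<- _]; apply: le_limn_einf => k.
exact: lagrangian_ge.
Qed.

Lemma lagrangian_ge_sqr x y : 0 <= x <= 1 -> ((y ^+ 2)%:E <= lagrangian x y)%E.
Proof.
rewrite /lagrangian => /andP[x0 x1]; case: ifPn => [x0'|].
  by rewrite lee_fin ler_pdivlMr// ler_piMr// sqr_ge0.
case: ifPn => [/andP[_ /eqP->] _|_ _]; last exact: leey.
by rewrite expr0n.
Qed.

Lemma lagrangian_le_of_sqr x y c : 0 <= x -> 0 <= c -> y ^+ 2 <= c * x ->
  (lagrangian x y <= c%:E)%E.
Proof.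
rewrite /lagrangian le_eqVlt => /predU1P[<-|x0] c0.
  rewrite mulr0 => y2; have /eqP : y ^+ 2 = 0.
    by apply/eqP; rewrite eq_le y2 sqr_ge0.
  by rewrite expf_eq0/= => ->; rewrite ltxx eqxx/= lee_fin.
by rewrite x0 lee_fin ler_pdivrMr.
Qed.

Lemma lagrangian_flux_le x v : 0 <= x ->
  (lagrangian x (- (v * x)) <= (v * v * x)%:E)%E.
Proof.
move=> x0; rewrite -expr2; apply: lagrangian_le => // a; rewrite lee_fin.
have := mulr_ge0 (sqr_ge0 (a + v)) x0; nra.
Qed.

Lemma le_lagrangian_velocity x y : 0 <= x ->
  (((- (y / x)) * (- (y / x)) * x)%:E <= lagrangian x y)%E.
Proof.
move=> x0; have [->|xn0] := eqVneq x 0.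
  by rewrite mulr0 lagrangian_ge0.
have := lagrangian_ge y (y / x) x0; congr (_ <= _)%E; congr EFin.
by field.
Qed.

Lemma lagrangian_lty x y : (lagrangian x y < +oo)%E -> x = 0 -> y = 0.
Proof.
rewrite /lagrangian => + x0; rewrite x0 ltxx eqxx/=.
by case: eqP => //; rewrite ltxx.
Qed.

(** The quotient is written with the power -1 of [x], which is a measurable
function of [x] on the whole line and the inverse where x > 0. *)
Lemma measurable_lagrangian (D : set R) (x y : R -> R) : measurable D ->
  measurable_fun D x -> measurable_fun D y ->
  measurable_fun D (fun t => lagrangian (x t) (y t)).
Proof.
move=> mD mx my.
rewrite (_ : (fun t => _) = (fun t => if 0 < x t then (y t ^+ 2 * x t `^ (-1))%:E
    else if (x t == 0) && (y t == 0) then 0%E else +oo%E)); last first.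
  apply/funext => t; rewrite /lagrangian; case: ifPn => // xt0.
  by rewrite powR_inv1// ltW.
have m0 : measurable_fun D (fun=> 0 : R) by [].
apply: measurable_fun_if => //.
- exact: measurable_fun_ltr.
- apply: measurable_funS (_ : measurable_fun D _); [by []|exact: subIsetl|].
  apply/measurable_EFinP; apply: measurable_funM; first exact: measurable_funX.
  exact: measurableT_comp (measurable_powR _) mx.
- apply: measurable_funS (_ : measurable_fun D _); [by []|exact: subIsetl|].
  apply: measurable_fun_if => //.
  by apply: measurable_and; exact: measurable_fun_eqr.
Qed.

End lagrangian.

(** * Primitives and the flux density *)

Section primitive.
Context {R : realType}.
Local Notation mu := (@lebesgue_measure R).
Local Notation I01 := (`[0%R, 1%R]%classic : set R).

Definition primitive (r : R) (g : R -> R) (t : R) : R :=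
  r + \int[mu]_(s in `[0, t]) g s.

Lemma primitive0 r g : primitive r g 0 = r.
Proof. by rewrite /primitive set_itv1 Rintegral_set1 addr0. Qed.

Lemma subset_itv01 (t : R) : t <= 1 -> `[0, t] `<=` I01.
Proof.
by move=> t1 s /=; rewrite !in_itv/= => /andP[-> st]; exact: le_trans st t1.
Qed.

Lemma integrable_sub01 (g : R -> R) t : t <= 1 ->
  mu.-integrable I01 (EFin \o g) -> mu.-integrable `[0, t] (EFin \o g).
Proof. by move=> t1; apply: integrableS => //; exact: subset_itv01. Qed.

Lemma primitive_mid r f g t : L2_01 f -> L2_01 g -> t <= 1 ->
  primitive r (fun s => (f s + g s) / 2) t =
  (primitive r f t + primitive r g t) / 2.
Proof.
move=> /L2_integrable/integrable_sub01 fi /L2_integrable/integrable_sub01 gi t1.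
have {}fi := fi _ t1; have {}gi := gi _ t1; rewrite /primitive.
have -> : \int[mu]_(s in `[0, t]) ((f s + g s) / 2) =
    2^-1 * (\int[mu]_(s in `[0, t]) f s + \int[mu]_(s in `[0, t]) g s).
  rewrite -RintegralD// -RintegralZl//; last exact: (integrableD _ fi gi).
  by apply: eq_Rintegral => s _; rewrite mulrC.
by field.
Qed.

Lemma measurable_primitive r g : L2_01 g -> measurable_fun I01 (primitive r g).
Proof.
move=> /L2_integrable gi; apply: measurable_funD => //.
apply: subspace_continuous_measurable_fun => //.
exact: (parameterized_integral_continuous ler01 gi).
Qed.

(** Domination on [0,1] yields convergence of the primitives at every time, so
that the curves converge everywhere although their rates converge only almost
everywhere. *)
Lemma primitive_cvg (A : finType) (f : nat -> A -> R -> R) h a r t :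
  (forall k, L2_01 (f k a)) -> L2_01 (h a) -> dominated_limit f h ->
  0 <= t <= 1 -> primitive r (f k a) t @[k --> \oo] --> primitive r (h a) t.
Proof.
move=> f2 h2 [G [iG _ fh fG]] /andP[t0 t1].
apply: cvgD; first exact: cvg_cst.
have sub := subset_itv01 t1.
have [] // := @dominated_convergence _ _ _ mu `[0, t] _
  (fun k => EFin \o f k a) (EFin \o h a) (EFin \o G).
- move=> k; apply/measurable_EFinP; case: (f2 k) => mf _.
  exact: measurable_funS mf.
- apply/measurable_EFinP; case: h2 => mh _.
  exact: measurable_funS mh.
- apply: ae_imply fh => s fs Ds; apply: cvg_EFin; first exact: nearW.
  by apply: fs; exact: sub.
- exact: integrable_sub01.
- apply: ae_imply fG => s fs k Ds; rewrite lee_fin.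
  by apply: fs; exact: sub.
move=> ih _ cv; apply: fine_cvg.
rewrite fineK; last exact: integrable_fin_num ih.
exact: cv.
Qed.

End primitive.

Section flux_density.
Context {R : realType} {N : nat}.
Variable E : rel 'I_N.
Implicit Types (r : 'rV[R]_N) (m : 'M[R]_N).
Local Notation I01 := (`[0%R, 1%R]%classic : set R).

Definition flux_density r m : \bar R :=
  ((4^-1)%:E * \sum_i \sum_(j | E i j) lagrangian (theta r i j) (m i j))%E.

Lemma theta_ge0 r i j : (forall k, 0 <= r 0 k) -> 0 <= theta r i j.
Proof. by move=> r0; rewrite divr_ge0 ?addr_ge0. Qed.

Lemma thetaC r i j : theta r i j = theta r j i.
Proof. by rewrite /theta addrC. Qed.

Lemma prob_simplex_le1 r i : prob_simplex r -> r 0 i <= 1.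
Proof.
by move=> [<- r0]; rewrite (bigD1 i)//= lerDl sumr_ge0.
Qed.

Lemma theta_01 r i j : prob_simplex r -> 0 <= theta r i j <= 1.
Proof.
move=> hr; rewrite theta_ge0 /=; last by case: hr.
have := prob_simplex_le1 i hr; have := prob_simplex_le1 j hr.
by rewrite /theta => *; lra.
Qed.

Lemma flux_density_ge0 r m : (forall k, 0 <= r 0 k) -> (0 <= flux_density r m)%E.
Proof.
move=> r0; rewrite mule_ge0 ?lee_fin//; apply: sume_ge0 => i _.
by apply: sume_ge0 => j _; apply: lagrangian_ge0; exact: theta_ge0.
Qed.

Lemma flux_density_ge_lagrangian r m i j : (forall k, 0 <= r 0 k) -> E i j ->
  ((4^-1)%:E * lagrangian (theta r i j) (m i j) <= flux_density r m)%E.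
Proof.
move=> r0 Eij; apply: lee_wpmul2l => //.
have L0 k l : (0 <= lagrangian (theta r k l) (m k l))%E.
  by apply: lagrangian_ge0; exact: theta_ge0.
rewrite (bigD1 i)//= (bigD1 (P := E i) j)//= -addeA leeDl//.
apply: adde_ge0; first exact: sume_ge0.
by apply: sume_ge0 => k _; exact: sume_ge0.
Qed.

Lemma flux_density_ge_sqr r m i j : prob_simplex r -> E i j ->
  ((4^-1 * m i j ^+ 2)%:E <= flux_density r m)%E.
Proof.
move=> hr Eij; apply: le_trans (flux_density_ge_lagrangian m _ Eij).
  rewrite EFinM; apply: lee_wpmul2l => //; apply: lagrangian_ge_sqr.
  exact: theta_01.
by case: hr.
Qed.

Lemma flux_density_le r m c : (forall k, 0 <= r 0 k) -> 0 <= c ->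
  (forall i j, E i j -> m i j ^+ 2 <= c * theta r i j) ->
  (flux_density r m <= (4^-1 * \sum_i \sum_(j | E i j) c)%:E)%E.
Proof.
move=> r0 c0 mc; rewrite EFinM; apply: lee_wpmul2l => //.
rewrite -sumEFin; apply: lee_sum => i _; rewrite -sumEFin.
apply: lee_sum => j Eij; apply: lagrangian_le_of_sqr => //.
  exact: theta_ge0.
exact: mc.
Qed.

Lemma flux_density_mid r1 r2 r m1 m2 m :
  (forall k, 0 <= r1 0 k) -> (forall k, 0 <= r2 0 k) ->
  (forall k, r 0 k = (r1 0 k + r2 0 k) / 2) ->
  (forall i j, m i j = (m1 i j + m2 i j) / 2) ->
  (flux_density r m <=
   2^-1%:E * flux_density r1 m1 + 2^-1%:E * flux_density r2 m2)%E.
Proof.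
move=> r10 r20 rE mE.
have L1 i j := lagrangian_ge0 (m1 i j) (theta_ge0 i j r10).
have L2 i j := lagrangian_ge0 (m2 i j) (theta_ge0 i j r20).
have S1 i : (0 <= \sum_(j | E i j) lagrangian (theta r1 i j) (m1 i j))%E.
  exact: sume_ge0.
have S2 i : (0 <= \sum_(j | E i j) lagrangian (theta r2 i j) (m2 i j))%E.
  exact: sume_ge0.
rewrite /flux_density !(muleCA _ (4^-1)%:E) -ge0_muleDr; last 2 first.
- by rewrite mule_ge0 ?lee_fin// sume_ge0.
- by rewrite mule_ge0 ?lee_fin// sume_ge0.
apply: lee_wpmul2l => //; rewrite !ge0_sume_distrr// -big_split/=.
apply: lee_sum => i _; rewrite !ge0_sume_distrr// -big_split/=.
apply: lee_sum => j _.
rewrite (_ : theta r i j = (theta r1 i j + theta r2 i j) / 2); last first.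
  by rewrite /theta !rE; field.
by rewrite mE; apply: lagrangian_mid; exact: theta_ge0.
Qed.

Lemma flux_density_lsc (r : nat -> 'rV[R]_N) (m : nat -> 'M[R]_N) r0 m0 :
  (forall k i, 0 <= r k 0 i) ->
  (forall i, r k 0 i @[k --> \oo] --> r0 0 i) ->
  (forall i j, m k i j @[k --> \oo] --> m0 i j) ->
  (flux_density r0 m0 <= limn_einf (fun k => flux_density (r k) (m k)))%E.
Proof.
move=> rk0 rr mm.
have L i j k := lagrangian_ge0 (m k i j) (theta_ge0 i j (rk0 k)).
rewrite /flux_density.
apply: le_trans (limn_einf_Zl _ _) => //; last first.
  by move=> k; apply: sume_ge0 => i _; exact: sume_ge0.
apply: lee_wpmul2l => //.
apply: le_trans (limn_einf_sum_le _ _ _); last first.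
  by move=> i k; exact: sume_ge0.
apply: lee_sum => i _.
apply: le_trans (limn_einf_sum_le _ _ _) => //.
apply: lee_sum => j _; apply: lagrangian_lsc => //.
  by move=> k; exact: theta_ge0.
by apply: cvgM; [apply: cvgD|exact: cvg_cst].
Qed.

Lemma measurable_theta (rho : R -> 'rV[R]_N) i j :
  (forall k, measurable_fun I01 (fun t => rho t 0 k)) ->
  measurable_fun I01 (fun t => theta (rho t) i j).
Proof.
by move=> mr; apply: measurable_funM => //; apply: measurable_funD; exact: mr.
Qed.

Lemma measurable_flux_density (rho : R -> 'rV[R]_N) (m : R -> 'M[R]_N) :
  (forall k, measurable_fun I01 (fun t => rho t 0 k)) ->
  (forall i j, measurable_fun I01 (fun t => m t i j)) ->
  measurable_fun I01 (fun t => flux_density (rho t) (m t)).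
Proof.
move=> mr mm; apply: emeasurable_funM => //.
apply: emeasurable_sum => i.
rewrite (_ : (fun t => _) = (fun t => \sum_j if E i j then
    lagrangian (theta (rho t) i j) (m t i j) else 0)%E); last first.
  by apply/funext => t; rewrite big_mkcond.
apply: emeasurable_sum => j; have [_|_] := boolP (E i j); last by [].

by apply: measurable_lagrangian => //; exact: measurable_theta.
Qed.

End flux_density.

(** * Admissible rates and fluxes *)

Section admissible.
Context {R : realType} {N : nat}.
Variables (E : rel 'I_N) (Sigma : 'rV[R]_N) (dW : R -> R).
Variables (rhoa rhob : 'rV[R]_N).
Local Notation mu := (@lebesgue_measure R).
Local Notation I01 := (`[0%R, 1%R]%classic : set R).

(** Indices of the unknown family: [inl i] for the rate of the mass at the node
i, [inr (i, j)] for the flux from i to j. *)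
Definition coord := ('I_N + 'I_N * 'I_N)%type.
Implicit Types f g h : coord -> R -> R.

Definition curve_of f (t : R) : 'rV[R]_N :=
  \row_i primitive (rhoa 0 i) (f (inl i)) t.

Definition flux_of f (t : R) : 'M[R]_N := \matrix_(i, j) f (inr (i, j)) t.

Definition continuity_equation f (t : R) : Prop := forall i,
  f (inl i) t + \sum_(j | E i j) f (inr (i, j)) t
  + \sum_(j | E i j)
      (Sigma 0 j - Sigma 0 i) * theta (curve_of f t) i j * dW t = 0.

(** The feasible set of the flux problem in terms of the family. Fluxes are
normalized to vanish off the edges: the action does not see them there, and
could not bound them. *)
Definition admissible f : Prop :=
  [/\ forall a, L2_01 (f a),
    forall t, I01 t -> forall i j, f (inr (i, j)) t = - f (inr (j, i)) t /\
      (~~ E i j -> f (inr (i, j)) t = 0),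
    forall t, I01 t -> prob_simplex (curve_of f t),
    curve_of f 1 = rhob &
    {ae mu, forall t, I01 t -> continuity_equation f t}].

Definition action f : \bar R := flux_action E (curve_of f, flux_of f).

Lemma actionE f :
  action f = (\int[mu]_(t in I01) flux_density E (curve_of f t) (flux_of f t))%E.
Proof. by []. Qed.

Lemma measurable_curve f k : (forall a, L2_01 (f a)) ->
  measurable_fun I01 (fun t => curve_of f t 0 k).
Proof.
move=> f2; rewrite (_ : (fun t => _) = primitive (rhoa 0 k) (f (inl k))).
  exact: measurable_primitive.
by apply/funext => t; rewrite mxE.
Qed.

Lemma measurable_density f : (forall a, L2_01 (f a)) ->
  measurable_fun I01 (fun t => flux_density E (curve_of f t) (flux_of f t)).
Proof.
move=> f2; apply: measurable_flux_density => [k|i j].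
  exact: measurable_curve.
rewrite (_ : (fun t => _) = f (inr (i, j))); first by case: (f2 (inr (i, j))).
by apply/funext => t; rewrite mxE.
Qed.

Lemma density_ge0 f t : admissible f -> I01 t ->
  (0 <= flux_density E (curve_of f t) (flux_of f t))%E.
Proof.
by move=> [_ _ fs _ _] It; apply: flux_density_ge0; have [] := fs t It.
Qed.

Lemma action_ge0 f : admissible f -> (0 <= action f)%E.
Proof. by move=> af; apply: integral_ge0 => t It; exact: density_ge0. Qed.

Lemma curve_of_mid f g t i : (forall a, L2_01 (f a)) -> (forall a, L2_01 (g a)) ->
  I01 t -> curve_of (midfam f g) t 0 i =
           (curve_of f t 0 i + curve_of g t 0 i) / 2.
Proof.
move=> f2 g2; rewrite I01E => /andP[_ t1]; rewrite !mxE.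
exact: primitive_mid.
Qed.

Lemma admissible_mid f g :
  admissible f -> admissible g -> admissible (midfam f g).
Proof.
move=> [f2 fm fs f1 fe] [g2 gm gs g1 ge]; split.
- by move=> a; exact: L2_mid.
- move=> t It i j; have [fij fE] := fm t It i j; have [gij gE] := gm t It i j.
  rewrite /midfam fij gij; split; first by field.
  by move=> nE; rewrite -fij -gij fE// gE// addr0 mul0r.
- move=> t It; have [fs1 fs0] := fs t It; have [gs1 gs0] := gs t It; split.
    under eq_bigr do rewrite curve_of_mid//.
    by rewrite -mulr_suml big_split/= fs1 gs1; field.
  by move=> i; rewrite curve_of_mid// divr_ge0 ?addr_ge0.
- apply/rowP => i; rewrite curve_of_mid// ?f1 ?g1; first by field.
  by rewrite I01E ler01 lexx.
- apply: ae_imply2 fe ge => t fe ge It i; have := fe It i; have := ge It i.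
  have -> : \sum_(j | E i j) midfam f g (inr (i, j)) t =
      (\sum_(j | E i j) f (inr (i, j)) t + \sum_(j | E i j) g (inr (i, j)) t) / 2.
    by rewrite -big_split/= mulr_suml.
  have -> : \sum_(j | E i j) (Sigma 0 j - Sigma 0 i) *
        theta (curve_of (midfam f g) t) i j * dW t =
      (\sum_(j | E i j) (Sigma 0 j - Sigma 0 i) * theta (curve_of f t) i j * dW t
     + \sum_(j | E i j) (Sigma 0 j - Sigma 0 i) * theta (curve_of g t) i j * dW t)
      / 2.
    rewrite -big_split/= mulr_suml; apply: eq_bigr => j _.
    by rewrite /theta !curve_of_mid//; field.
  by rewrite /midfam; move=> *; lra.
Qed.

Lemma action_mid f g (c : \bar R) : admissible f -> admissible g ->
  (action f <= c)%E -> (action g <= c)%E -> (action (midfam f g) <= c)%E.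
Proof.
move=> af ag fc gc; have [f2 _ fs _ _] := af; have [g2 _ gs _ _] := ag.
have am := admissible_mid af ag; have [m2 _ _ _ _] := am.
have mf := measurable_density f2; have mg := measurable_density g2.
have f0 := density_ge0 af; have g0 := density_ge0 ag.
have le1 : (action (midfam f g) <=
    \int[mu]_(t in I01)
      (2^-1%:E * flux_density E (curve_of f t) (flux_of f t) +
       2^-1%:E * flux_density E (curve_of g t) (flux_of g t)))%E.
  rewrite actionE; apply: ge0_le_integral => //.
  - by move=> t It; exact: density_ge0.
  - exact: measurable_density.
  - by apply: emeasurable_funD; apply: emeasurable_funM => //.
  - move=> t It; apply: flux_density_mid.
    + by case: (fs t It).
    + by case: (gs t It).
    + by move=> k; rewrite curve_of_mid.
    + by move=> i j; rewrite !mxE.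
exact: le_trans le1 (integral_mid_le mf f0 mg g0 fc gc).
Qed.

Lemma admissible_closed (f : nat -> coord -> R -> R) h (c : R) :
  (forall k, admissible (f k)) ->
  (forall k, action (f k) <= (c + k.+1%:R^-1)%:E)%E ->
  (forall a, L2_01 (h a)) -> dominated_limit f h ->
  admissible h /\ (action h <= c%:E)%E.
Proof.
move=> af Jf h2 fh.
have f2 k a : L2_01 (f k a) by case: (af k).
have fm k t (It : I01 t) i j : f k (inr (i, j)) t = - f k (inr (j, i)) t /\
    (~~ E i j -> f k (inr (i, j)) t = 0).
  by case: (af k) => _ /(_ t It).
have fs k t (It : I01 t) : prob_simplex (curve_of (f k) t).
  by case: (af k) => _ _ /(_ t It).
have cc t i : I01 t -> curve_of (f k) t 0 i @[k --> \oo] --> curve_of h t 0 i.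
  rewrite I01E => It; rewrite mxE; under eq_fun do rewrite mxE.
  by apply: primitive_cvg.
have [G [_ dich aefh _]] := fh.
have hs t : I01 t -> prob_simplex (curve_of h t).
  move=> It; split.
    have : \sum_j curve_of (f k) t 0 j @[k --> \oo] --> \sum_j curve_of h t 0 j.
      by apply: cvg_sumr => j _; exact: cc.
    rewrite (_ : (fun k => _) = fun=> 1); last first.
      by apply/funext => k; case: (fs k t It).
    by move=> /cvg_lim <-//; rewrite lim_cst.
  move=> i; have := cc t i It => ci; rewrite -(cvg_lim _ ci)//.
  apply: limr_ge; first exact: cvgP ci.
  by apply: nearW => k; case: (fs k t It).
have hadm : admissible h.
  split=> //.
  - move=> t It i j; have [ft|h0] := dich t It; last by rewrite !h0 oppr0.
    split.
      rewrite -(cvg_lim _ (ft (inr (i, j))))// -(cvg_lim _ (ft (inr (j, i))))//.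
      under eq_fun do rewrite (fm _ t It i j).1.
      by rewrite limN//; exact: cvgP (ft _).
    move=> nE; rewrite -(cvg_lim _ (ft (inr (i, j))))//.
    under eq_fun do rewrite (fm _ t It i j).2//.
    by rewrite lim_cst.
  - apply/rowP => i; have I1 : I01 1 by rewrite I01E ler01 lexx.
    have := cc 1 i I1 => /cvg_lim <-//.
    rewrite (_ : (fun k => _) = fun=> rhob 0 i); first by rewrite lim_cst.
    by apply/funext => k; case: (af k) => _ _ _ ->.
  - have aef : {ae mu, forall t k, I01 t -> continuity_equation (f k) t}.
      by apply: ae_forall_nat => k; case: (af k).
    apply: ae_imply2 aef aefh => t fe ft It i.
    have {}ft := ft It.
    have cv : (f k (inl i) t + \sum_(j | E i j) f k (inr (i, j)) t
      + \sum_(j | E i j) (Sigma 0 j - Sigma 0 i) *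
          theta (curve_of (f k) t) i j * dW t) @[k --> \oo] -->
      h (inl i) t + \sum_(j | E i j) h (inr (i, j)) t
      + \sum_(j | E i j) (Sigma 0 j - Sigma 0 i) *
          theta (curve_of h t) i j * dW t.
      apply: cvgD; first apply: cvgD => //; apply: cvg_sumr => j _ //.
      apply: cvgM; last exact: cvg_cst.
      apply: cvgM; first exact: cvg_cst.
      by apply: cvgM; [apply: cvgD; exact: cc|exact: cvg_cst].
    move/cvg_lim : cv => <-//.
    rewrite (_ : (fun k => _) = fun=> 0); first by rewrite lim_cst.
    by apply/funext => k; exact: fe.
split=> //; rewrite actionE.
apply: (fatou_le (F := fun k t =>
    flux_density E (curve_of (f k) t) (flux_of (f k) t))
  (e := fun k => k.+1%:R^-1)) => //.
- by move=> k; apply: measurable_density; exact: f2.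
- by move=> k t It; exact: density_ge0.
- exact: measurable_density.
- by move=> t It; exact: density_ge0.
- apply: ae_imply aefh => t ft It; apply: flux_density_lsc.
  + by move=> k i; case: (fs k t It).
  + by move=> i; exact: cc.
  + move=> i j; rewrite mxE; under eq_fun do rewrite mxE.
    exact: ft.
- exact: cvg_harmonic.
Qed.

End admissible.

(** * Coercivity, and the passage between velocities and fluxes *)

Section bridge.
Context {R : realType} {N : nat}.
Variables (E : rel 'I_N) (Sigma : 'rV[R]_N) (dW : R -> R).
Variables (rhoa rhob : 'rV[R]_N).
Local Notation mu := (@lebesgue_measure R).
Local Notation I01 := (`[0%R, 1%R]%classic : set R).
Local Notation admissible := (admissible E Sigma dW rhoa rhob).
Local Notation action := (action E rhoa).
Local Notation curve_of := (curve_of rhoa).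

Lemma sqr_sum_le (x : 'I_N -> R) (P : pred 'I_N) :
  (\sum_(j | P j) x j) ^+ 2 <= N%:R * \sum_(j | P j) x j ^+ 2.
Proof.
pose y j := if P j then x j else 0.
rewrite (big_mkcond P) [X in _ <= _ * X](big_mkcond P)/=.
rewrite [X in _ <= _ * X](_ : _ = \sum_j y j ^+ 2); last first.
  by apply: eq_bigr => j _; rewrite /y; case: ifP => // _; rewrite expr0n.
rewrite -/(\sum_j y j) expr2 mulr_suml.
have -> : N%:R * \sum_j y j ^+ 2 =
    \sum_i \sum_j (2^-1 * (y i ^+ 2 + y j ^+ 2)).
  under [RHS]eq_bigr do rewrite -mulr_sumr big_split/= sumr_const card_ord.
  rewrite -mulr_sumr big_split/= sumr_const card_ord sumrMnl -mulr_natl.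
  by field.
apply: ler_sum => i _; rewrite mulr_sumr; apply: ler_sum => j _.
by have := sqr_ge0 (y i - y j); lra.
Qed.

(** Here [d] is the rate at a node, [x] the fluxes and [n] the noise term of
the continuity equation; [r] stands for the flux density. *)
Lemma sqr_velocity_le (x : 'I_N -> R) (P : pred 'I_N) (d n B r : R) :
  0 <= r -> (forall j, P j -> 4^-1 * x j ^+ 2 <= r) -> `|n| <= B ->
  d + \sum_(j | P j) x j + n = 0 ->
  d ^+ 2 <= 8 * N%:R ^+ 2 * r + 2 * B ^+ 2.
Proof.
move=> r0 xr nB dE.
have dE' : d = - (\sum_(j | P j) x j + n) by lra.
have n2 : n ^+ 2 <= B ^+ 2.
  rewrite -(real_normK (num_real n)) lerXn2r ?nnegrE//.
  exact: le_trans (normr_ge0 n) nB.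
have S2 : \sum_(j | P j) x j ^+ 2 <= N%:R * (4 * r).
  have -> : N%:R * (4 * r) = \sum_(j < N) 4 * r.
    by rewrite sumr_const card_ord mulr_natl.
  rewrite [leLHS]big_mkcond/=; apply: ler_sum => j _; case: ifPn => [/xr|_].
    by move=> ?; lra.
  by rewrite mulr_ge0.
have := sqr_sum_le x P; move: S2 dE'.
set S := \sum_(j | P j) x j; set Q := \sum_(j | P j) _ => S2 -> SQ.
have NQ : N%:R * Q <= N%:R * (N%:R * (4 * r)) by rewrite ler_wpM2l.
have := sqr_ge0 (S - n); rewrite expr2.
have -> : 8 * N%:R ^+ 2 * r = 2 * (N%:R * (N%:R * (4 * r))) by ring.
move: NQ; set T := N%:R * (N%:R * _) => NQ.
by nra.
Qed.

Lemma noise_le (r : 'rV[R]_N) (w B : R) i : prob_simplex r -> `|w| <= B ->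
  `|\sum_(j | E i j) (Sigma 0 j - Sigma 0 i) * theta r i j * w| <=
  \sum_i \sum_j `|Sigma 0 j - Sigma 0 i| * B.
Proof.
move=> hr wB; have B0 : 0 <= B := le_trans (normr_ge0 w) wB.
apply: le_trans (ler_norm_sum _ _ _) _.
rewrite [leRHS](bigD1 i)//=; apply: ler_wpDr.
  by apply: sumr_ge0 => k _; apply: sumr_ge0 => j _; rewrite mulr_ge0.
rewrite [leLHS]big_mkcond/=; apply: ler_sum => j _; case: ifPn => _; last first.
  by rewrite mulr_ge0.
have /andP[t0 t1] := theta_01 i j hr.
rewrite normrM normrM (ger0_norm t0); apply: ler_pM => //.
  by rewrite mulr_ge0.
by rewrite ler_piMr.
Qed.

Lemma sqr_le_flux_density (r : 'rV[R]_N) (m : 'M[R]_N) i j :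
  prob_simplex r -> E i j -> ((m i j ^+ 2)%:E <= 4%:E * flux_density E r m)%E.
Proof.
move=> hr Eij; have four0 : (0 <= 4%:E :> \bar R)%E by rewrite lee_fin.
have := lee_wpmul2l four0 (flux_density_ge_sqr m hr Eij).
by rewrite -EFinM mulrA divff// mul1r.
Qed.

Lemma action_coercive (B : R) : (forall t, I01 t -> `|dW t| <= B) ->
  forall c : R, exists M : R, forall f, admissible f -> (action f <= c%:E)%E ->
    forall a, sqnorm (f a) <= M.
Proof.
move=> dWB c.
pose B' := \sum_i \sum_j `|Sigma 0 j - Sigma 0 i| * B.
exists (4 * c + (8 * N%:R ^+ 2 * c + 2 * B' ^+ 2)) => f af fc a.
have [f2 fm fs _ fe] := af.
have c0 : 0 <= c by rewrite -lee_fin; exact: le_trans (action_ge0 af) fc.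
have mD := measurable_density E rhoa f2.
have D0 := density_ge0 af.
have B0 : 0 <= 2 * B' ^+ 2 by rewrite mulr_ge0// sqr_ge0.
have Nc0 : 0 <= 8 * N%:R ^+ 2 * c by rewrite !mulr_ge0// exprn_ge0.
case: a => [i|[i j]].
  apply: (@le_trans _ _ (8 * N%:R ^+ 2 * c + 2 * B' ^+ 2)); last first.
    by rewrite lerDr mulr_ge0.
  rewrite -lee_fin sqnormE//.
  apply: (@le_trans _ _ (\int[mu]_(t in I01)
     ((8 * N%:R ^+ 2)%:E * flux_density E (curve_of f t) (flux_of f t) +
      (2 * B' ^+ 2)%:E))%E).
    apply: ae_ge0_le_integral => //.
    - by move=> t _; rewrite lee_fin sqr_ge0.
    - by apply: measurable_sqr; case: (f2 (inl i)).
    - move=> t It; apply: adde_ge0; last by rewrite lee_fin.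
      by apply: mule_ge0; [rewrite lee_fin mulr_ge0// exprn_ge0|exact: D0].
    - by apply: emeasurable_funD => //; apply: emeasurable_funM => //.
    - apply: ae_imply fe => t fe It.
      have := D0 t It.
      have mr j : E i j -> ((4^-1 * f (inr (i, j)) t ^+ 2)%:E <=
          flux_density E (curve_of f t) (flux_of f t))%E.
        move=> Eij; have := flux_density_ge_sqr (flux_of f t) (fs t It) Eij.
        by rewrite mxE.
      move: mr; case: (flux_density _ _ _) => [r mr|_ _|//].
        rewrite lee_fin => r0; rewrite -EFinM -EFinD lee_fin.
        apply: (sqr_velocity_le r0 _ _ (fe It i)) => //.
        by apply: noise_le; [exact: fs|exact: dWB].
      rewrite gt0_muley ?addye ?leey//.
      by rewrite lte_fin mulr_gt0// exprn_gt0// ltr0n; case: (N) i => // -[].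
  rewrite ge0_integralD//; last 2 first.
  - move=> t It; apply: mule_ge0; last exact: D0.
    by rewrite lee_fin mulr_ge0// exprn_ge0.
  - by apply: emeasurable_funM => //.
  rewrite integral_cst//= lebesgue_measure_itv/= lte_fin ltr01 -EFinD subr0 mule1.
  rewrite EFinD leeD2r// ge0_integralZl//.
  by rewrite [leRHS]EFinM; apply: lee_wpmul2l.
apply: (@le_trans _ _ (4 * c)); last by rewrite lerDl addr_ge0.
have [Eij|nE] := boolP (E i j); last first.
  rewrite (_ : sqnorm _ = 0) ?mulr_ge0// /sqnorm.
  rewrite (_ : \int[mu]_(t in I01) _ = \int[mu]_(t in I01) 0).
    by rewrite Rintegral_cst//= mul0r.
  apply: eq_Rintegral => t; rewrite inE => It.
  by rewrite (fm t It i j).2// expr0n.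
rewrite -lee_fin sqnormE//.
apply: (@le_trans _ _ (\int[mu]_(t in I01)
     (4%:E * flux_density E (curve_of f t) (flux_of f t)))%E).
  apply: ge0_le_integral => //.
  - by move=> t _; rewrite lee_fin sqr_ge0.
  - by apply: measurable_sqr; case: (f2 (inr (i, j))).
  - by apply: emeasurable_funM => //.
  - move=> t It; have := sqr_le_flux_density (flux_of f t) (fs t It) Eij.
    by rewrite mxE.
by rewrite ge0_integralZl// EFinM; apply: lee_wpmul2l.
Qed.


Lemma admissible_flux_feasible f : admissible f ->
  flux_feasible E Sigma dW rhoa rhob (curve_of f, flux_of f).
Proof.
move=> [f2 fm fs f1 fe]; split=> //=.
- split.
    move=> t It; apply/matrixP => i j; rewrite !mxE.
    have It' : I01 t by rewrite I01E.
    by have [] := fm t It' j i.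
  move=> i j; rewrite (_ : (fun t => _) = f (inr (i, j)))//.
  by apply/funext => t; rewrite mxE.
- by apply/rowP => i; rewrite mxE primitive0.
- exists (fun t => \row_i f (inl i) t); split.
    split=> [i|t It]; last by apply: fs; rewrite I01E.
    rewrite (_ : (fun t => _) = primitive (rhoa 0 i) (f (inl i))); last first.
      by apply/funext => t; rewrite mxE.
    rewrite (_ : (fun t => _) = f (inl i)); last first.
      by apply/funext => t; rewrite mxE.
    by split=> // t _; rewrite primitive0.
  apply: ae_imply fe => t; rewrite I01E => fe It i; rewrite mxE.
  under eq_bigr do rewrite mxE.
  exact: fe.
Qed.

Hypothesis symE : symmetric E.

Lemma flux_feasible_admissible p :
  flux_feasible E Sigma dW rhoa rhob p ->
  exists2 f, admissible f & action f = flux_action E p.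
Proof.
case: p => rho m [/= [mskew m2] rho0 rho1 [drho [[drhoE rhos] eq_ae]]].
pose f (a : coord) t : R := match a with
  | inl i => drho t 0 i
  | inr (i, j) => if E i j then m t i j else 0 end.
have cE t : I01 t -> curve_of f t = rho t.
  rewrite I01E => It; apply/rowP => i; rewrite mxE /primitive.
  by have [_ /(_ t It) ->] := drhoE i; rewrite rho0.
exists f.
  split.
  - case=> [i|[i j]] /=; first by case: (drhoE i).
    rewrite /f; have [_|_] := boolP (E i j); first exact: m2.
    by apply: (L2_bounded (c := 0)) => // t _; rewrite normr0.
  - move=> t It i j /=; rewrite symE; case: (E j i); last by rewrite oppr0.
    split=> //; have : skew (m t) by apply: mskew; rewrite -I01E.
    by move=> /matrixP/(_ j i); rewrite !mxE.
  - by move=> t It; rewrite cE//; apply: rhos; rewrite -I01E.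
  - by rewrite cE// I01E ler01 lexx.
  - apply: ae_imply eq_ae => t + It; rewrite -I01E => /(_ It) H i.
    rewrite -[RHS](H i) cE//; congr (_ + _ + _).
    by apply: eq_bigr => j Eij /=; rewrite Eij.
rewrite actionE /flux_action; apply: eq_integral => t; rewrite inE => It.
rewrite /flux_density cE//; congr (_ * _)%E.
by apply: eq_bigr => i _; apply: eq_bigr => j Eij; rewrite mxE /= Eij.
Qed.

Lemma measurable_kinetic (rho : R -> 'rV[R]_N) (v : R -> 'M[R]_N) :
  (forall k, measurable_fun I01 (fun t => rho t 0 k)) ->
  (forall i j, measurable_fun I01 (fun t => v t i j)) ->
  measurable_fun I01 (fun t => (2^-1 * inner_theta E (rho t) (v t) (v t))%:E).
Proof.
move=> mrho mv; apply/measurable_EFinP; apply: measurable_funM => //.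
apply: measurable_funM => //; apply: measurable_sum => i.
rewrite (_ : (fun t => _) = (fun t => \sum_j if E i j then
    v t i j * v t i j * theta (rho t) i j else 0)); last first.
  by apply/funext => t; rewrite big_mkcond.
apply: measurable_sum => j; have [_|_] := boolP (E i j); last by [].
apply: measurable_funM; first exact: measurable_funM.
exact: measurable_theta.
Qed.

Lemma kinetic_densityE (r : 'rV[R]_N) (v : 'M[R]_N) :
  (2^-1 * inner_theta E r v v)%:E =
  ((4^-1)%:E * \sum_i \sum_(j | E i j) (v i j * v i j * theta r i j)%:E)%E.
Proof.
under [in RHS]eq_bigr do rewrite sumEFin.
rewrite sumEFin -EFinM; congr EFin; rewrite /inner_theta mulrA; congr (_ * _).
by field.
Qed.

Lemma kinetic_ge0 (r : 'rV[R]_N) (v : 'M[R]_N) : (forall k, 0 <= r 0 k) ->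
  0 <= 2^-1 * inner_theta E r v v.
Proof.
move=> r0; rewrite !mulr_ge0//; apply: sumr_ge0 => i _; apply: sumr_ge0 => j _.
by rewrite mulr_ge0 ?theta_ge0// -expr2 sqr_ge0.
Qed.

(** Where theta = 0, division returns 0, which is the right velocity because
the flux vanishes there almost everywhere when the action is finite. *)
Definition velocity_of f (t : R) : 'M[R]_N :=
  \matrix_(i, j) - (f (inr (i, j)) t / theta (curve_of f t) i j).

(** The velocity satisfies its continuity equation because m = - theta v almost
everywhere; where theta = 0 this says m = 0, which holds as soon as the flux
density is finite, hence almost everywhere if the action is. *)
Lemma velocity_of_feasible f : admissible f -> (action f < +oo)%E ->
  velocity_feasible E Sigma dW rhoa rhob (curve_of f, velocity_of f) /\
  (kinetic_energy E (curve_of f, velocity_of f) <= action f)%E.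
Proof.
move=> af foo; have [f2 fm fs f1 fe] := af.
have [_ c0 _ [drho [H1 eq_ae]]] := admissible_flux_feasible af.
have mc k := measurable_curve rhoa k f2.
have mv i j : measurable_fun I01 (fun t => velocity_of f t i j).
  have mg : measurable_fun I01
      (fun t => - (f (inr (i, j)) t * theta (curve_of f t) i j `^ (-1))).
    apply: measurableT_comp => //; apply: measurable_funM.
      by case: (f2 (inr (i, j))).
    apply: measurableT_comp (measurable_powR _) _.
    exact: measurable_theta.
  apply: eq_measurable_fun mg => t; rewrite inE => It.
  by rewrite mxE powR_inv1// theta_ge0; have [] := fs t It.
split; last first.
  rewrite /kinetic_energy actionE; apply: ge0_le_integral => //.
  - by move=> t It; rewrite lee_fin; apply: kinetic_ge0; case: (fs t It).
  - exact: measurable_kinetic.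
  - exact: measurable_density.
  - move=> t It; rewrite kinetic_densityE; apply: lee_wpmul2l => //=.
    apply: lee_sum => i _; apply: lee_sum => j _; rewrite !mxE.
    by apply: le_lagrangian_velocity; apply: theta_ge0; case: (fs t It).
split=> //=.
- split=> // t It; apply/matrixP => i j; rewrite !mxE thetaC.
  have It' : I01 t by rewrite I01E.
  by have [-> _] := fm t It' j i; rewrite mulNr.
- exists drho; split=> //.
  have D0 := density_ge0 af.
  have iD : mu.-integrable I01
      (fun t => flux_density E (curve_of f t) (flux_of f t)).
    apply/integrableP; split; first exact: measurable_density.
    apply: le_lt_trans foo; rewrite actionE le_eqVlt; apply/orP; left; apply/eqP.
    apply: eq_integral => t; rewrite inE => It; rewrite gee0_abs//.
    exact: D0.
  apply: ae_imply2 eq_ae (integrable_ae _ iD) => // t + + It.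
  rewrite I01E => /(_ It) eq /(_ It) fin i.
  have {}It : I01 t by rewrite I01E.
  have r0 : forall k, 0 <= curve_of f t 0 k by case: (fs t It).
  rewrite -[RHS](eq i) /graph_div; congr (_ + _ + _).
    rewrite -sumrN; apply: eq_bigr => j Eij; rewrite !mxE mulNr opprK.
    have [th0|thn0] := eqVneq (theta (curve_of f t) i j) 0; last first.
      by rewrite divfK.
    rewrite th0 mulr0; apply/esym/(lagrangian_lty _ th0).
    have := flux_density_ge_lagrangian (flux_of f t) r0 Eij.
    rewrite mxE; move: fin; case: (flux_density _ _ _) => // r _.
    case: (lagrangian _ _) => [s _|H|_]; [exact: ltry| |by []].
    by move: H; rewrite gt0_muley ?lte_fin ?invr_gt0.
  rewrite mulNr mulr_suml -sumrN; apply: eq_bigr => j _.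
  by rewrite !mxE -!mulNr opprB.
Qed.

(** The flux - theta v is square integrable because theta <= 1 gives
(theta v)^2 <= theta v^2, whose integral is the energy up to a factor. *)
Lemma velocity_feasible_flux p : velocity_feasible E Sigma dW rhoa rhob p ->
  (kinetic_energy E p < +oo)%E ->
  exists2 f, admissible f & (action f <= kinetic_energy E p)%E.
Proof.
case: p => rho v [/= [vskew mv] rho0 rho1 [drho [H1 eq_ae]]] koo.
have [drhoE rhos] := H1.
have mrho k : measurable_fun I01 (fun t => rho t 0 k).
  have [drho2 dE] := drhoE k.
  have := measurable_primitive (rho 0 0 k) drho2.
  by apply: eq_measurable_fun => t; rewrite inE I01E => It; rewrite (dE t It).
pose m t : 'M[R]_N :=
  \matrix_(i, j) if E i j then - (v t i j * theta (rho t) i j) else 0.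
have rs t : I01 t -> prob_simplex (rho t) by rewrite I01E; exact: rhos.
have r0 t : I01 t -> forall k, 0 <= rho t 0 k by move=> /rs[].
have mkin := measurable_kinetic mrho mv.
have mm i j : measurable_fun I01 (fun t => m t i j).
  rewrite (_ : (fun t => _) = (fun t => if E i j then
    - (v t i j * theta (rho t) i j) else 0)); last first.
    by apply/funext => t; rewrite mxE.
  case: (E i j) => //; apply: measurableT_comp => //.
  apply: measurable_funM => //.
  exact: measurable_theta.
have mk t : I01 t -> (flux_density E (rho t) (m t) <=
    (2^-1 * inner_theta E (rho t) (v t) (v t))%:E)%E.
  move=> It; rewrite kinetic_densityE; apply: lee_wpmul2l => //=.
  apply: lee_sum => i _; apply: lee_sum => j Eij; rewrite mxE Eij.
  by apply: lagrangian_flux_le; apply: theta_ge0; exact: r0.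
have flux_p : flux_feasible E Sigma dW rhoa rhob (rho, m).
  split=> //=.
  - split.
      move=> t It; apply/matrixP => i j; rewrite !mxE symE thetaC.
      case: (E i j); last by rewrite oppr0.
      by have /matrixP/(_ i j) := vskew t It; rewrite !mxE => ->; rewrite mulNr.
    move=> i j; have [Eij|nE] := boolP (E i j); last first.
      apply: (L2_bounded (c := 0)) => // t _.
      by rewrite mxE (negbTE nE) normr0.
    apply: (L2_le (g := fun t =>
      (4%:E * (2^-1 * inner_theta E (rho t) (v t) (v t))%:E)%E)) => //.
    + move=> t It; apply: le_trans (sqr_le_flux_density _ (rs t It) Eij) _.
      by apply: lee_wpmul2l => //; exact: mk.
    + by apply: emeasurable_funM.
    + rewrite ge0_integralZl//; last first.
        by move=> t It; rewrite lee_fin; apply: kinetic_ge0; exact: r0.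
      rewrite lte_mul_pinfty//.
  - exists drho; split=> //; apply: ae_imply eq_ae => t + It => /(_ It) eq i.
    rewrite -[RHS](eq i) /graph_div; congr (_ + _ + _).
      by rewrite -sumrN; apply: eq_bigr => j Eij; rewrite mxE Eij.
    rewrite mulNr mulr_suml -sumrN; apply: eq_bigr => j _.
    by rewrite !mxE -!mulNr opprB.
have [f af fE] := flux_feasible_admissible flux_p.
exists f => //; rewrite fE; apply: ge0_le_integral => //.
- by move=> t It; apply: flux_density_ge0; exact: r0.
- exact: measurable_flux_density.
Qed.

End bridge.

(** * The driving path, and flows on a connected graph *)

Section wong_zakai.
Context {R : realType}.
Variables (K : nat) (w : R -> R).
Local Notation I01 := (`[0%R, 1%R]%classic : set R).

Definition wz_slope (k : nat) : R :=
  (w (k.+1%:R * K%:R^-1) - w (k%:R * K%:R^-1)) / K%:R^-1.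

(** Writing the slope as a finite sum of step functions gives its measurability
and a bound at once. *)
Definition wz_step (k : nat) (t : R) : R :=
  if (k%:R <= t * K%:R) && (t * K%:R < k.+1%:R) then wz_slope k else 0.

Lemma wong_zakai_derivE t : 0 <= t <= 1 ->
  wong_zakai_deriv K w t = \sum_(k < K.+1) wz_step k t.
Proof.
move=> /andP[t0 t1]; have tK0 : 0 <= t * K%:R by rewrite mulr_ge0.
have tkt := truncn_itv tK0.
have kK : (Num.truncn (t * K%:R) < K.+1)%N.
  rewrite -(ltr_nat R); case/andP: tkt => /le_lt_trans + _; apply.
  by apply: (@le_lt_trans _ _ K%:R); rewrite ?ltr_nat// ler_piMl.
rewrite (bigD1 (Ordinal kK))//= big1 ?addr0; first by rewrite /wz_step tkt.
move=> j jk; rewrite /wz_step; case: ifPn => // /truncn_def jE.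
by case/negP: jk; apply/eqP/val_inj.
Qed.

Lemma wong_zakai_bounded :
  exists B, forall t, I01 t -> `|wong_zakai_deriv K w t| <= B.
Proof.
exists (\sum_(k < K.+1) `|wz_slope k|) => t; rewrite /= in_itv/= => It.
rewrite wong_zakai_derivE//; apply: le_trans (ler_norm_sum _ _ _) _.
by apply: ler_sum => k _; rewrite /wz_step; case: ifP => // _; rewrite normr0.
Qed.

Lemma measurable_wong_zakai : measurable_fun I01 (wong_zakai_deriv K w).
Proof.
have ms : measurable_fun I01 (fun t => \sum_(k < K.+1) wz_step k t).
  apply: measurable_sum => k; apply: measurable_fun_if => //.
  by apply: measurable_and;
    [apply: measurable_fun_ler|apply: measurable_fun_ltr] => //;
    apply: measurable_funM.
apply: eq_measurable_fun ms => t; rewrite inE /= in_itv/= => It.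
by rewrite wong_zakai_derivE.
Qed.

End wong_zakai.

Section flows.
Context {R : realType} {N : nat}.
Variable E : rel 'I_N.

(** A flow on the edges with prescribed net outflow [b] at each node: a
preimage of [b] under the divergence of the graph. *)
Definition flow (b : 'I_N -> R) (u : 'M[R]_N) : Prop :=
  [/\ forall i j, u i j = - u j i, forall i j, ~~ E i j -> u i j = 0 &
    forall i, \sum_(j | E i j) u i j = b i].

Lemma flow_lincomb b1 b2 u1 u2 (c1 c2 : R) : flow b1 u1 -> flow b2 u2 ->
  flow (fun i => c1 * b1 i + c2 * b2 i) (c1 *: u1 + c2 *: u2).
Proof.
move=> [sk1 E1 s1] [sk2 E2 s2]; split=> [i j|i j nE|i].
- by rewrite !mxE sk1 sk2 !mulrN -opprD.
- by rewrite !mxE E1// E2// !mulr0 addr0.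
- under eq_bigr do rewrite !mxE.
  by rewrite big_split/= -!mulr_sumr s1 s2.
Qed.

Lemma flow0 : flow (fun=> 0) 0.
Proof.
split=> [i j|i j _|i]; rewrite ?mxE ?oppr0//.
by rewrite big1// => j _; rewrite mxE.
Qed.

Lemma flow_ext b b' u : b =1 b' -> flow b u -> flow b' u.
Proof. by move=> bb [? ? s]; split=> // i; rewrite s. Qed.

Hypothesis symE : symmetric E.

Lemma flow_edge x y : E x y ->
  flow (fun i => (i == x)%:R - (i == y)%:R) (delta_mx x y - delta_mx y x).
Proof.
move=> Exy; split=> [i j|i j nE|i].
- by rewrite !mxE opprB ![(i == _) && _]andbC.
- rewrite !mxE; have -> : (i == x) && (j == y) = false.
    by apply/negP => /andP[/eqP ix /eqP jy]; move: nE; rewrite ix jy Exy.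
  have -> : (i == y) && (j == x) = false.
    by apply/negP => /andP[/eqP ix /eqP jy]; move: nE; rewrite ix jy symE Exy.
  by rewrite subr0.
- under eq_bigr do rewrite !mxE.
  have row k l : E k l ->
      \sum_(j | E i j) ((i == k) && (j == l))%:R = (i == k)%:R :> R.
    move=> Ekl; have [->|_] := eqVneq i k; last by rewrite big1.
    rewrite (bigD1 l)//= eqxx big1 ?addr0// => j /andP[_ /negbTE ->].
    by [].
  by rewrite sumrB !row// symE.
Qed.

Lemma flow_path x y : connect E x y ->
  exists u, flow (fun i => (i == x)%:R - (i == y)%:R) u.
Proof.
move=> /connectP[p]; elim: p x => [|z p IH] x /=.
  by move=> _ ->; exists 0; apply: flow_ext flow0 => i; rewrite subrr.
move=> /andP[Exz pz] yE; have [u fu] := IH z pz yE.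
exists (1 *: (delta_mx x z - delta_mx z x) + 1 *: u).
apply: flow_ext (flow_lincomb 1 1 (flow_edge Exz) fu) => i.
by rewrite !mul1r subrKA.
Qed.

(** Send the mass b y from each node y to a fixed root along a path; what
arrives at the root is the total mass of [b], which is 0. *)
Lemma flow_exists (b : 'I_N -> R) : (forall i j, connect E i j) ->
  \sum_i b i = 0 -> exists u, flow b u.
Proof.
move=> conn b0.
have [x0 _|none] := pickP (@predT 'I_N); last first.
  by exists 0; split=> i; have := none i.
have [u uP] : exists u, flow (fun i =>
    \sum_y b y * ((i == y)%:R - (i == x0)%:R)) u.
  elim: (index_enum _) => [|y s [u fu]].
    by exists 0; apply: flow_ext flow0 => i; rewrite big_nil.
  have [u' fu'] := flow_path (conn y x0).
  exists (b y *: u' + 1 *: u).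
  apply: flow_ext (flow_lincomb (b y) 1 fu' fu) => i.
  by rewrite big_cons mul1r.
exists u; apply: flow_ext uP => i.
under eq_bigr do rewrite mulrBr.
rewrite sumrB -mulr_suml b0 mul0r subr0 (bigD1 i)//= eqxx mulr1 big1 ?addr0//.
by move=> j ji; rewrite eq_sym (negbTE ji) mulr0.
Qed.

End flows.

(** * A competitor of finite action *)

Section polynomials.
Context {R : realType}.
Local Notation mu := (@lebesgue_measure R).
Local Notation I01 := (`[0%R, 1%R]%classic : set R).

Lemma continuous_poly (p : {poly R}) : continuous (fun t => p.[t]).
Proof.
move=> t; apply/differentiable_continuous/derivable1_diffP.
exact: derivable_horner.
Qed.

Lemma poly_FTC (p : {poly R}) t : 0 <= t ->
  p.[t] = p.[0] + \int[mu]_(s in `[0, t]) (p^`()).[s].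
Proof.
rewrite le_eqVlt => /predU1P[<-|t0].
  by rewrite set_itv1 Rintegral_set1 addr0.
have cp x : {for x, continuous (fun t => p.[t])} by exact: continuous_poly.
rewrite /Rintegral (continuous_FTC2 (F := horner p) t0); last 3 first.
- by apply: continuous_subspaceT; exact: continuous_poly.
- split=> [x _||]; first exact: derivable_horner.
    exact: cvg_at_right_filter (cp 0).
  exact: cvg_at_left_filter (cp t).
- by move=> x _; rewrite derivE.
by rewrite -EFinB/= addrC subrK.
Qed.

Lemma measurable_poly (p : {poly R}) (D : set R) :
  measurable_fun D (fun t => p.[t]).
Proof.
apply: measurable_funTS; apply: continuous_measurable_fun.
exact: continuous_poly.
Qed.

Lemma L2_poly (p : {poly R}) : L2_01 (fun t => p.[t]).
Proof.
split; first exact: measurable_poly.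
have : mu.-integrable I01 (EFin \o (fun t => (p ^+ 2).[t])).
  apply: continuous_compact_integrable; first exact: segment_compact.
  by apply: continuous_subspaceT; exact: continuous_poly.
move=> /integrable_lty => /(_ (measurable_itv _)).
by under eq_integral do rewrite /= horner_exp.
Qed.

End polynomials.

Section competitor.
Context {R : realType} {N : nat}.
Variables (E : rel 'I_N) (Sigma : 'rV[R]_N) (dW : R -> R) (B : R).
Hypotheses (graphE : simple_connected_graph E).
Hypothesis mdW : measurable_fun (`[0%R, 1%R]%classic : set R) dW.
Hypothesis dWB : forall t, (`[0%R, 1%R]%classic : set R) t -> `|dW t| <= B.
Variables (rhoa rhob : 'rV[R]_N).
Hypotheses (rhoaP : prob_simplex rhoa) (rhobP : prob_simplex rhob).
Local Notation mu := (@lebesgue_measure R).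
Local Notation I01 := (`[0%R, 1%R]%classic : set R).

(** The smoothstep 3 t^2 - 2 t^3: its derivative 6 t (1 - t) vanishes at both
ends, where the curve may leave or reach the boundary of the simplex. *)
Definition clock : {poly R} := 3%:P * ('X * 'X) - 2%:P * ('X * 'X * 'X).

Definition bezier (a b c : R) : {poly R} :=
  (1%:P - clock) * (1%:P - clock) * a%:P + clock * clock * b%:P
  + 2%:P * (clock * (1%:P - clock)) * c%:P.

Lemma clockE t : clock.[t] = 3 * t ^+ 2 - 2 * t ^+ 3.
Proof. by rewrite /clock !hornerE; ring. Qed.

Lemma bezierE a b c t : (bezier a b c).[t] =
  (1 - clock.[t]) ^+ 2 * a + clock.[t] ^+ 2 * b
  + 2 * (clock.[t] * (1 - clock.[t])) * c.
Proof. by rewrite /bezier !hornerE; ring. Qed.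

Lemma deriv_bezier a b c t : ((bezier a b c)^`()).[t] =
  6 * (t * (1 - t)) *
  (2 * (1 - clock.[t]) * (c - a) + 2 * clock.[t] * (b - c)).
Proof.
have clock' : (clock^`()).[t] = 6 * (t * (1 - t)).
  rewrite /clock derivB !derivM !derivC !derivX !(mulr1, mul1r, mul0r, add0r).
  by rewrite !(hornerM, hornerD, hornerN, hornerC, hornerX); ring.
rewrite -clock' /bezier; move: clock => s.
rewrite !(derivD, derivM, derivN, derivC).
by rewrite !(hornerM, hornerD, hornerN, hornerC); ring.
Qed.

(** The last bound compares the square of the speed 6 t (1 - t) with the mass
2 s (1 - s) / N that the Bezier curve, at the parameter s given by the clock,
puts on every node. *)
Lemma clock_bounds t : 0 <= t <= 1 ->
  [/\ 0 <= clock.[t], clock.[t] <= 1 &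
      (t * (1 - t)) ^+ 2 <= clock.[t] * (1 - clock.[t])].
Proof.
move=> /andP[t0 t1].
have s1 : t ^+ 2 <= clock.[t].
  rewrite clockE -subr_ge0 (_ : _ - _ = 2 * t ^+ 2 * (1 - t)); last by ring.
  by rewrite !mulr_ge0 ?sqr_ge0 ?subr_ge0.
have s2 : (1 - t) ^+ 2 <= 1 - clock.[t].
  rewrite clockE -subr_ge0 (_ : _ - _ = 2 * (1 - t) ^+ 2 * t); last by ring.
  by rewrite !mulr_ge0 ?sqr_ge0 ?subr_ge0.
split; first exact: le_trans (sqr_ge0 _) s1.
  by rewrite -subr_ge0; exact: le_trans (sqr_ge0 _) s2.
by rewrite exprMn; apply: ler_pM => //; exact: sqr_ge0.
Qed.

(** Every node carries mass at least 2 s (1 - s) / N at the parameter s of the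
Bezier curve, so the square of the speed is O(theta). The flux splits into a
part realizing the rate, linear in the speed, and a part cancelling the noise,
which is O(theta); both have a square that is O(theta), so the flux density is
bounded. *)
Lemma finite_action_competitor : exists2 p,
  flux_feasible E Sigma dW rhoa rhob p & (flux_action E p < +oo)%E.
Proof.
have [symE _ conn] := graphE.
have [ra1 ra0] := rhoaP; have [rb1 rb0] := rhobP.
have N0 : (0 < N)%N.
  case: (N) rhoa ra1 => // r /esym/eqP; rewrite big_ord0 oner_eq0//.
have NR0 : 0 < N%:R :> R by rewrite ltr0n.
pose c : R := N%:R^-1.
have c0 : 0 < c by rewrite invr_gt0.
have sumc : \sum_(i < N) c = 1.
  by rewrite sumr_const card_ord -mulr_natl divff// gt_eqF.
have [ua [ska Ea sa]] : exists u, flow E (fun i => c - rhoa 0 i) u.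
  by apply: flow_exists => //; rewrite sumrB sumc ra1 subrr.
have [ub [skb Eb sb]] : exists u, flow E (fun i => rhob 0 i - c) u.
  by apply: flow_exists => //; rewrite sumrB sumc rb1 subrr.
pose rho (t : R) : 'rV[R]_N := \row_i (bezier (rhoa 0 i) (rhob 0 i) c).[t].
pose drho (t : R) : 'rV[R]_N :=
  \row_i ((bezier (rhoa 0 i) (rhob 0 i) c)^`()).[t].
pose m0 (t : R) i j := 6 * (t * (1 - t)) *
  (2 * (1 - clock.[t]) * ua i j + 2 * clock.[t] * ub i j).
pose noise (t : R) i j := (Sigma 0 j - Sigma 0 i) * theta (rho t) i j * dW t.
pose m (t : R) : 'M[R]_N :=
  \matrix_(i, j) if E i j then - m0 t i j - noise t i j else 0.
have rhoP t : 0 <= t <= 1 -> prob_simplex (rho t).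
  move=> It; have [s0 s1 _] := clock_bounds It; split.
    under eq_bigr do rewrite mxE bezierE.
    rewrite !big_split/= -!mulr_sumr ra1 rb1 sumc; ring.
  move=> i; rewrite mxE bezierE.
  rewrite -subr_ge0 in s1.
  by rewrite !addr_ge0// !mulr_ge0 ?sqr_ge0// ltW.
have mrho k : measurable_fun I01 (fun t => rho t 0 k).
  rewrite (_ : (fun t => _) = fun t => (bezier (rhoa 0 k) (rhob 0 k) c).[t]).
    exact: measurable_poly.
  by apply/funext => t; rewrite mxE.
have mm i j : measurable_fun I01 (fun t => m t i j).
  rewrite (_ : (fun t => _) = (fun t => if E i j then
    - m0 t i j - noise t i j else 0)); last first.
    by apply/funext => t; rewrite mxE.
  have [_|_] := boolP (E i j); last by [].
  apply: measurable_funB.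
    rewrite (_ : (fun t => _) = (fun t => (- (6%:P * ('X * (1 - 'X)) *
      (2%:P * (1 - clock) * (ua i j)%:P + 2%:P * clock * (ub i j)%:P))).[t])).
      exact: measurable_poly.
    by apply/funext => t; rewrite /m0 !hornerE.
  apply: measurable_funM => //; apply: measurable_funM => //.
  exact: measurable_theta.
pose U := \sum_i \sum_j (`|ua i j| + `|ub i j|).
pose V := \sum_i \sum_j `|Sigma 0 j - Sigma 0 i|.
pose C := 2 * (72 * N%:R * U ^+ 2 + (V * B) ^+ 2).
have term_le (F : 'I_N -> 'I_N -> R) i j : (forall i j, 0 <= F i j) ->
    F i j <= \sum_i \sum_j F i j.
  move=> F0; rewrite (bigD1 i)//= (bigD1 j)//= -addrA lerDl addr_ge0//.
    exact: sumr_ge0.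
  by apply: sumr_ge0 => k _; exact: sumr_ge0.
have C0 : 0 <= C.
  by rewrite mulr_ge0// addr_ge0 ?sqr_ge0// mulr_ge0 ?sqr_ge0// mulr_ge0// ltW.
have mC t i j : 0 <= t <= 1 -> m t i j ^+ 2 <= C * theta (rho t) i j.
  move=> It; have hr := rhoP t It.
  have /andP[th0 th1] := theta_01 i j hr.
  rewrite mxE; case: ifP => [Eij|_]; last by rewrite expr0n mulr_ge0.
  have [s0 s1 ts] := clock_bounds It.
  have th : 18 * N%:R * theta (rho t) i j >= (6 * (t * (1 - t))) ^+ 2.
    have lo k : 2 * (t * (1 - t)) ^+ 2 * c <= rho t 0 k.
      rewrite mxE bezierE; apply: (@le_trans _ _
        (2 * (clock.[t] * (1 - clock.[t])) * c)).
        by rewrite ler_pM2r// ler_pM2l.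
      by rewrite lerDr addr_ge0// mulr_ge0 ?sqr_ge0.
    have : 2 * (t * (1 - t)) ^+ 2 * c <= theta (rho t) i j.
      by have := lo i; have := lo j; rewrite /theta; lra.
    move=> /(ler_wpM2l (ltW NR0)).
    rewrite (_ : N%:R * (2 * (t * (1 - t)) ^+ 2 * c) = 2 * (t * (1 - t)) ^+ 2).
      by rewrite [X in _ <= X]mulrC => H; rewrite [leLHS]exprMn; lra.
    by rewrite mulrCA divff ?mulr1// gt_eqF.
  have m0le : m0 t i j ^+ 2 <= 72 * N%:R * U ^+ 2 * theta (rho t) i j.
    pose X := 2 * (1 - clock.[t]) * ua i j + 2 * clock.[t] * ub i j.
    have XU : X ^+ 2 <= (2 * U) ^+ 2.
      have XU' : `|X| <= 2 * U.
        have := term_le (fun i j => `|ua i j| + `|ub i j|) i j _.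
        move=> /(_ (fun i j => addr_ge0 (normr_ge0 _) (normr_ge0 _))) UU.
        apply: (@le_trans _ _ (2 * (`|ua i j| + `|ub i j|))); last first.
          by rewrite ler_pM2l.
        rewrite mulrDr; apply: le_trans (ler_normD _ _) _.
        rewrite !normrM (ger0_norm s0) (@ger0_norm _ (1 - _)) ?subr_ge0//.
        rewrite (@ger0_norm _ 2)//; apply: lerD; apply: ler_wpM2r => //.
          by lra.
        by lra.
      rewrite -(real_normK (num_real X)) lerXn2r ?nnegrE//.
      exact: le_trans XU'.
    rewrite /m0 -/X exprMn.
    apply: (@le_trans _ _ (18 * N%:R * theta (rho t) i j * (2 * U) ^+ 2)).
      by apply: ler_pM => //; exact: sqr_ge0.
    by rewrite le_eqVlt; apply/orP; left; apply/eqP; ring.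
  have nle : noise t i j ^+ 2 <= (V * B) ^+ 2 * theta (rho t) i j.
    have VB : `|(Sigma 0 j - Sigma 0 i) * dW t| <= V * B.
      rewrite normrM; apply: ler_pM => //.
        exact: (term_le (fun i j => `|Sigma 0 j - Sigma 0 i|)).
      by apply: dWB; rewrite I01E.
    rewrite /noise mulrAC exprMn; apply: ler_pM; try exact: sqr_ge0.
      rewrite -(real_normK (num_real (_ * dW t))) lerXn2r ?nnegrE//.
      exact: le_trans VB.
    by rewrite expr2 ler_piMr.
  have := sqr_ge0 (m0 t i j - noise t i j).
  rewrite /C; nra.
exists (rho, m).
  split=> /=.
  - split.
      move=> t It; apply/matrixP => i j; rewrite !mxE symE.
      case: (E i j); last by rewrite oppr0.
      by rewrite /m0 /noise ska skb thetaC; ring.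
    move=> i j; apply: (L2_le_sqr_integrable (g := fun=> C)) => //.
      move=> t It; apply: le_trans (mC t i j _) _; first by rewrite -I01E.
      rewrite ler_piMr//.
      by have /andP[] := theta_01 i j (rhoP t It).
    by apply: (integrable_bounded01 (c := `|C|)).
  - apply/rowP => i; rewrite mxE bezierE clockE; ring.
  - apply/rowP => i; rewrite mxE bezierE clockE; ring.
  - exists drho; split.
      split=> // i.
      rewrite (_ : (fun t => rho _ _ _) =
          fun t => (bezier (rhoa 0 i) (rhob 0 i) c).[t]); last first.
        by apply/funext => t; rewrite mxE.
      rewrite (_ : (fun t => drho _ _ _) =
          fun t => ((bezier (rhoa 0 i) (rhob 0 i) c)^`()).[t]); last first.
        by apply/funext => t; rewrite mxE.
      split; first exact: L2_poly.
      by move=> t /andP[t0 _]; exact: poly_FTC.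
    apply: aeW => t It i; rewrite mxE deriv_bezier.
    have -> : \sum_(j | E i j) m t i j =
       - (\sum_(j | E i j) m0 t i j) - \sum_(j | E i j) noise t i j.
      rewrite -sumrN -sumrB; apply: eq_bigr => j Eij; by rewrite mxE Eij.
    rewrite -mulr_sumr big_split/= -!mulr_sumr sa sb.
    by rewrite /noise; ring.
apply: (@le_lt_trans _ _ (\int[mu]_(t in I01)
    (4^-1 * \sum_i \sum_(j | E i j) C)%:E)%E).
  apply: ge0_le_integral => //.
  - by move=> t It; apply: flux_density_ge0; case: (rhoP t It).
  - exact: measurable_flux_density.
  - move=> t It; apply: flux_density_le => //; first by case: (rhoP t It).
    by move=> i j _; exact: mC.
rewrite integral_cst//= lebesgue_measure_itv/= lte_fin ltr01 -EFinD subr0 mule1.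
exact: ltry.
Qed.

End competitor.

(** * Common minimizers *)

(** A minimizer of the flux problem gives a feasible velocity with no more
energy, and every velocity of finite energy gives a flux with no more action;
so the chain kinetic(rho, v) <= action(rho, m) <= action(m') <= kinetic(v')
closes. *)
Theorem pathwise_common_minimizer (R : realType) (N : nat) (E : rel 'I_N)
    (Sigma : 'rV[R]_N) (dW : R -> R) (B : R) (rhoa rhob : 'rV[R]_N) :
  simple_connected_graph E ->
  measurable_fun (`[0%R, 1%R]%classic : set R) dW ->
  (forall t, (`[0%R, 1%R]%classic : set R) t -> `|dW t| <= B) ->
  prob_simplex rhoa -> prob_simplex rhob ->
  exists (rho : R -> 'rV[R]_N) (v m : R -> 'M[R]_N),
    is_minimizer (velocity_feasible E Sigma dW rhoa rhob)
      (kinetic_energy E) (rho, v) /\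
    is_minimizer (flux_feasible E Sigma dW rhoa rhob)
      (flux_action E) (rho, m).
Proof.
move=> graphE mdW dWB rhoaP rhobP; have [symE _ _] := graphE.
have [p0 p0F p0oo] := finite_action_competitor Sigma graphE mdW dWB rhoaP rhobP.
have [f0 f0A f0E] := flux_feasible_admissible symE p0F.
have [||||||f fA fmin] := @L2_direct_method _ _
  (admissible E Sigma dW rhoa rhob) (action E rhoa).
- by move=> f [].
- by move=> f; exact: action_ge0.
- move=> f g c fA gA fc gc; split; first exact: admissible_mid.
  exact: action_mid fA gA fc gc.
- exact: action_coercive dWB.
- by move=> f h c fA fc h2; exact: admissible_closed.
- by exists f0 => //; rewrite f0E.
have foo : (action E rhoa f < +oo)%E.
  by apply: le_lt_trans (fmin _ f0A) _; rewrite f0E.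
have [vF vle] := velocity_of_feasible fA foo.
exists (curve_of rhoa f), (velocity_of rhoa f), (flux_of f).
split; split => //.
- move=> y yF.
  have [yoo|] := boolP (kinetic_energy E y < +oo)%E; last first.
    by rewrite -leNgt leye_eq => /eqP ->; exact: leey.
  have [g gA gle] := velocity_feasible_flux symE yF yoo.
  exact: le_trans vle (le_trans (fmin _ gA) gle).
- exact: admissible_flux_feasible.
- move=> y yF; have [g gA <-] := flux_feasible_admissible symE yF.
  exact: fmin.
Qed.

Theorem theorem5p1 (R : realType) (N : nat) (E : rel 'I_N)
    (hE : simple_connected_graph E) (Sigma : 'rV[R]_N)
    (d : measure_display) (T : measurableType d) (P : probability T R)
    (W : R -> {RV P >-> R}) (hW : standard_wiener W)
    (K : nat) (hK : (0 < K)%N) :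
  {ae P, forall omega, forall rhoa rhob : 'rV[R]_N,
    prob_simplex rhoa -> prob_simplex rhob ->
    exists (rho : R -> 'rV[R]_N) (v m : R -> 'M[R]_N),
      let dW := wong_zakai_deriv K (fun t => W t omega) in
      is_minimizer (velocity_feasible E Sigma dW rhoa rhob)
        (kinetic_energy E) (rho, v) /\
      is_minimizer (flux_feasible E Sigma dW rhoa rhob)
        (flux_action E) (rho, m)}.
Proof.
apply: aeW => omega rhoa rhob rhoaP rhobP.
have [B dWB] := wong_zakai_bounded K (fun t => W t omega).
have mdW := measurable_wong_zakai K (fun t => W t omega).
exact: (pathwise_common_minimizer Sigma hE mdW dWB rhoaP rhobP).
Qed.
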